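(* Let $\alpha>0$ and let $C=\begin{pmatrix}c_1&c_{12}\\c_{12}&c_2\end{pmatrix}$ be a symmetric positive definite matrix. Let $a>-1/2$, $b>0$ and $c>1$ satisfy $$a=\alpha-\tfrac12,\qquad b=2\,\frac{c_1c_2-c_{12}^2}{\sqrt{(c_1+c_2)^2-4(c_1c_2-c_{12}^2)}},\qquad c=\frac{c_1+c_2}{\sqrt{(c_1+c_2)^2-4(c_1c_2-c_{12}^2)}}.$$ Then a McKay Type I random variable with parameters $a,b,c$ can be represented as a projection of a bivariate gamma random vector with degree of freedom $2\alpha$ and covariance matrix $C$: if $(G_1,G_2)$ is such a bivariate gamma vector, then $G_1+G_2$ has the McKay Type I distribution with parameters $a,b,c$.
   Context: A random variable follows the type I McKay distribution with parameters $a>-1/2$, $b>0$, $c>1$ if its probability density function is supported on $\mathbb{R}_+$ and proportional there to $x^ae^{-xc/b}I_a(x/b)$, where $I_a$ is the modified Bessel function of the first kind of order $a$. A random vector $(G_1,G_2)$ has a bivariate gamma distribution (in the sense of Krishnamoorthy and Parthasarathy) with degree of freedom $2\alpha$ and covariance matrix $C$ if its characteristic function is $\phi(t_1,t_2)=|I_2-iCT|^{-\alpha}$ for $t_1,t_2\ge0$, where $T=\mathrm{diag}(t_1,t_2)$, $|\cdot|$ is the determinant and the power is the continuous branch equal to $1$ at $t=0$. It is assumed that $C$ and $\alpha$ are such that this is a bona fide characteristic function. *)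

(* Defs.v *)
From HB Require Import structures.
From mathcomp Require Import all_boot all_order all_algebra complex.
From mathcomp Require Import all_classical all_reals all_analysis.
From mathcomp Require Import measurable_realfun.

Set Implicit Arguments.
Unset Strict Implicit.
Unset Printing Implicit Defensive.

Import Order.TTheory GRing.Theory Num.Theory.
Import numFieldNormedType.Exports.

Local Open Scope classical_set_scope.
Local Open Scope ring_scope.

(* Euler's integral; used only at arguments where it converges (x > 0). *)
Definition Gamma (R : realType) (x : R) : R :=
  \int[lebesgue_measure]_(t in `]0, +oo[%classic) (t `^ (x - 1) * expR (- t)).

(* I_a(x) = sum_k (x/2)^(2k+a) / (k! Gamma(k+a+1)), for x > 0 *)
Definition besselI (R : realType) (a x : R) : R :=
  limn (series (fun k : nat =>
    (x / 2) `^ (k.*2%:R + a) / (k`!%:R * Gamma (k%:R + a + 1)))).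

Definition mckayI_kernel (R : realType) (a b c x : R) : R :=
  x `^ a * expR (- (x * c / b)) * besselI a (x / b).

(* The point 0 is left out of the support since the kernel is x^(2a) up to a
   continuous positive factor there, hence unbounded when a < 0. *)
Definition mckayI_distributed d (T : measurableType d) (R : realType)
    (P : probability T R) (X : {RV P >-> R}) (a b c : R) : Prop :=
  exists k : R, 0 < k /\
    forall A : set R, measurable A ->
      distribution P X A =
      (\int[lebesgue_measure]_(x in A)
         (k * ((mckayI_kernel a b c) \_ `]0, +oo[) x)%:E)%E.

Arguments mckayI_distributed {d T R} P X a b c.

Definition sym2_mx (R : realType) (c1 c12 c2 : R) : 'M[R]_2 :=
  \matrix_(i, j) if i != j then c12 else if i == 0 then c1 else c2.

Definition posdef_mx (R : realType) n (A : 'M[R]_n) : Prop :=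
  A^T = A /\ forall x : 'cV[R]_n, x != 0 -> 0 < (x^T *m A *m x) 0 0.

Definition expC (R : realType) (z : R[i]) : R[i] :=
  (expR (complex.Re z) * cos (complex.Im z) +i*
   (expR (complex.Re z) * sin (complex.Im z)))%C.

(* E[exp(i(t1 X + t2 Y))] *)
Definition charfun2 d (T : measurableType d) (R : realType)
    (P : probability T R) (X Y : {RV P >-> R}) (t : R * R) : R[i] :=
  (fine 'E_P[fun w => cos (t.1 * X w + t.2 * Y w)] +i*
   fine 'E_P[fun w => sin (t.1 * X w + t.2 * Y w)])%C.

Arguments charfun2 {d T R} P X Y t.

Definition quadrant (R : realType) : set (R * R) :=
  [set t | 0 <= t.1 /\ 0 <= t.2].

(* |I_2 - i C T| with T = diag(t1, t2) *)
Definition bigamma_det (R : realType) (C : 'M[R]_2) (t : R * R) : R[i] :=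
  let T := diag_mx (\row_(j < 2) if j == 0 then t.1 else t.2) in
  \det (1%:M - 'i%C *: map_mx (real_complex R) (C *m T)).

(* p is the branch of f^r on D that is continuous and equal to 1 at t0:
   p = exp(r L) for a continuous determination L of log f with L(t0) = 0. *)
Definition cont_power_branch (R : realType) (D : set (R * R)) (t0 : R * R)
    (f : R * R -> R[i]) (r : R) (p : R * R -> R[i]) : Prop :=
  exists L : R * R -> R[i],
    [/\ {within D, continuous (fun t => complex.Re (L t))},
        {within D, continuous (fun t => complex.Im (L t))},
        L t0 = 0 &
        forall t, D t -> expC (L t) = f t /\ p t = expC (r%:C%C * L t)].

Definition bivariate_gamma d (T : measurableType d) (R : realType)
    (P : probability T R) (G1 G2 : {RV P >-> R}) (df : R) (C : 'M[R]_2) : Prop :=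
  cont_power_branch (@quadrant R) (0, 0) (bigamma_det C) (- (df / 2))
    (charfun2 P G1 G2).

Arguments bivariate_gamma {d T R} P G1 G2 df C.

(* Main.v *)
(** Write [r = c / b]. Expanding the Bessel function displays the McKay density
as a positive series of gamma densities of rate [r], dominated by a single gamma
density of rate [r - 1 / b]. Integrating by parts term by term, its Fourier
transform [psi] solves
  [((r - i t)^2 - b^-2) psi'(t) = 2 i alpha (r - i t) psi(t)],
whence [psi(t) = psi(0) ((1 - i l1 t) (1 - i l2 t))^(- alpha)] with
[l1 = b / (c - 1)] and [l2 = b / (c + 1)]. The relations between [a, b, c] and [C]
say that [l1] and [l2] are the eigenvalues of [C], so that
[|I - i t C| = (1 - i l1 t) (1 - i l2 t)], and the continuous branch of its power
[- alpha] is the characteristic function of [G1 + G2]. The two laws agree because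
a Fourier transform determines a law: integrated against [exp (- e t)], it gives
the smoothing by the Cauchy kernel [e / (e^2 + x^2)], and [e -> 0] recovers the mass
of every interval [`]p, q]]. *)

Require Import Defs.
From HB Require Import structures.
From mathcomp Require Import all_boot all_order all_algebra complex.
From mathcomp Require Import all_classical all_reals all_analysis.
From mathcomp Require Import measurable_realfun.
From mathcomp Require Import ring lra.
Import Order.TTheory GRing.Theory Num.Theory.
Import numFieldNormedType.Exports.
Local Open Scope classical_set_scope.
Local Open Scope ring_scope.

Set Implicit Arguments.
Unset Strict Implicit.
Unset Printing Implicit Defensive.

(** * Integration on the positive half line *)

(** The law of the pair is given only through its transform at nonnegative arguments, and [G1 + G2]
    sees only the diagonal. Hence transforms are compared only for [t >= 0], through cosine and sine
    integrals over a half line. They decay like [t^(- 2 alpha)], so they fail to be integrable when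
    [alpha <= 1/2]; this is why inversion needs the damping [exp (- e t)]. Each gamma transform
    could be evaluated as [Gamma s (r - i t)^(- s)] and the results summed as a binomial series. The
    differential equation avoids this: no complex power or branch occurs on the McKay side, every
    identity splits into two real ones, and the equation itself needs only the two-term recurrence
    of the Bessel coefficients. The total mass [psi(0)] is not evaluated either: its inverse serves
    as normalising constant. *)

Section Rintegrable.
Context d (T : measurableType d) (R : realType).
Variables (mu : {measure set T -> \bar R}) (D : set T).
Hypothesis mD : measurable D.
Implicit Types (f g : T -> R).

Lemma Rintegrable_measurable f : mu.-integrable D (EFin \o f) -> measurable_fun D f.
Proof. by move=> /integrableP[/measurable_EFinP]. Qed.

Lemma RintegrableD f g :
  mu.-integrable D (EFin \o f) -> mu.-integrable D (EFin \o g) ->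
  mu.-integrable D (EFin \o (fun x => f x + g x)).
Proof. by move=> intf intg; exact: (integrableD mD intf intg). Qed.

Lemma RintegrableB f g :
  mu.-integrable D (EFin \o f) -> mu.-integrable D (EFin \o g) ->
  mu.-integrable D (EFin \o (fun x => f x - g x)).
Proof. by move=> intf intg; exact: (integrableB mD intf intg). Qed.

Lemma RintegrableZl (k : R) f :
  mu.-integrable D (EFin \o f) -> mu.-integrable D (EFin \o (fun x => k * f x)).
Proof. by move=> intf; exact: (integrableZl mD k intf). Qed.

Lemma le_Rintegrable f g : measurable_fun D f ->
  (forall x, D x -> `|f x| <= g x) -> mu.-integrable D (EFin \o g) ->
  mu.-integrable D (EFin \o f).
Proof.
move=> mf fg intg; apply: (@le_integrable _ _ _ mu _ mD _ _ _ _ intg).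
  exact/measurable_EFinP.
by move=> x Dx /=; rewrite lee_fin (le_trans (fg _ Dx))// ler_norm.
Qed.

Lemma RintegrableM_le1 f (h : T -> R) : mu.-integrable D (EFin \o f) ->
  measurable_fun D h -> (forall x, `|h x| <= 1) ->
  mu.-integrable D (EFin \o (fun x => f x * h x)).
Proof.
move=> intf mh h1; apply: (@le_Rintegrable _ (fun x => `|f x|)).
- by apply: measurable_funM => //; exact: Rintegrable_measurable.
- by move=> x _; rewrite normrM ler_piMr.
- exact: integrable_norm.
Qed.

End Rintegrable.

Lemma Rintegral_dominated_cvg d (T : measurableType d) (R : realType)
    (mu : {measure set T -> \bar R}) (D : set T) (f_ : nat -> T -> R)
    (f g : T -> R) :
  measurable D -> (forall n, measurable_fun D (f_ n)) ->
  (forall x, D x -> f_ n x @[n --> \oo] --> f x) ->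
  mu.-integrable D (EFin \o g) ->
  (forall n x, D x -> `|f_ n x| <= g x) ->
  mu.-integrable D (EFin \o f) /\
  \int[mu]_(x in D) f_ n x @[n --> \oo] --> \int[mu]_(x in D) f x.
Proof.
move=> mD mf_ f_f ig f_g.
have mf : measurable_fun D f by exact: measurable_fun_cvg f_f.
have [] := @dominated_convergence _ _ _ mu D mD (fun n => EFin \o f_ n)
  (EFin \o f) (EFin \o g).
- by move=> n; exact/measurable_EFinP.
- exact/measurable_EFinP.
- by apply: aeW => x Dx; apply: cvg_EFin; [exact: nearW|exact: f_f].
- exact: ig.
- by apply: aeW => x n Dx; rewrite lee_fin; exact: f_g.
move=> intf _ h; split => //; apply: fine_cvg.
by rewrite fineK// integrable_fin_num.
Qed.

Lemma measurable_itv0y (R : realType) :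
  measurable (`]0%R, +oo[%classic : set (measurableTypeR R)).
Proof. exact: measurable_itv. Qed.

(** * Improper integrals on the open half line from an antiderivative *)

Section FTC_itv0y.
Context {R : realType}.
Notation mu := (@lebesgue_measure R).
Implicit Types f F : R -> R.

Let E (n : nat) : set R := `[n.+1%:R^-1, n.+1%:R]%classic.

Let E_pos n : E n `<=` `]0, +oo[.
Proof.
move=> x; rewrite /E /= !in_itv/= => /andP[nx _].
by rewrite andbT (lt_le_trans _ nx)// invr_gt0.
Qed.

Let nearE (x : R) : 0 < x -> \forall n \near \oo, E n x.
Proof.
move=> x0; near=> n; rewrite /E/= in_itv/=; apply/andP; split.
  rewrite invf_ple ?posrE//; apply: (@le_trans _ _ n%:R); last by rewrite ler_nat.
  by near: n; exact: nbhs_infty_ger.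
apply: (@le_trans _ _ n%:R); last by rewrite ler_nat.
by near: n; exact: nbhs_infty_ger.
Unshelve. all: by end_near. Qed.

Let ndE : {homo E : n m / (n <= m)%N >-> (n <= m)%O}.
Proof.
move=> n m nm; rewrite subsetEset => x; rewrite /E/= !in_itv/= => /andP[nx xn].
apply/andP; split.
  by apply: le_trans nx; rewrite lef_pV2 ?posrE// ler_nat.
by apply: (le_trans xn); rewrite ler_nat.
Qed.

Let bigcupE : \bigcup_n E n = `]0, +oo[%classic.
Proof.
apply/seteqP; split => [x [n _]|x]; first exact: E_pos.
rewrite /= in_itv/= andbT => x0; have [n _ En] := nearE x0.
by exists n => //; apply: En => /=.
Qed.

Lemma measurable_itv0y_continuous f :
  (forall x, 0 < x -> {for x, continuous f}) -> measurable_fun (`]0, +oo[ : set R) f.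
Proof.
move=> cf; apply: open_continuous_measurable_fun; first exact: interval_open.
by move=> x; rewrite inE/= in_itv/= andbT => /cf.
Qed.

Variables (F f : R -> R) (l0 l1 : R).
Hypothesis F'f : forall x : R, 0 < x -> is_derive x 1 F (f x).
Hypothesis cf : forall x : R, 0 < x -> {for x, continuous f}.
Hypothesis F0 : F x @[x --> 0^'+] --> l0.
Hypothesis Fy : F x @[x --> +oo] --> l1.

(** The index is shifted because [E 0] is the single point 1, while the fundamental theorem of
    calculus asks for distinct endpoints. *)
Let integral_E n :
  (\int[mu]_(x in E n.+1) (f x)%:E)%E = (F n.+2%:R - F n.+2%:R^-1)%:E.
Proof.
rewrite EFinB; apply: continuous_FTC2.
- by rewrite (@lt_trans _ _ 1) ?ltr1n// invf_lt1// ltr1n.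
- apply: continuous_in_subspaceT => x; rewrite inE => /E_pos/=.
  by rewrite in_itv/= andbT => /cf.
- have dF (x : R) : 0 < x -> F y @[y --> x] --> F x.
    move=> x0; apply: differentiable_continuous; apply/derivable1_diffP.
    by case: (F'f x0).
  split.
  + move=> x; rewrite in_itv/= => /andP[nx _].
    by apply: ex_derive; apply: F'f; rewrite (lt_trans _ nx)// invr_gt0.
  + by apply: cvg_at_right_filter; apply: dF; rewrite invr_gt0.
  + by apply: cvg_at_left_filter; apply: dF.
- move=> x; rewrite in_itv/= => /andP[nx _]; rewrite derive1E.
  by apply: derive_val; apply: F'f; rewrite (lt_trans _ nx)// invr_gt0.
Qed.

Let cvgF : (F n.+2%:R - F n.+2%:R^-1) @[n --> \oo] --> l1 - l0.
Proof.
apply: cvgB.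
  move/cvg_pinftyP : Fy => /(_ (fun n => n.+2%:R)); apply.
  apply/cvgryPge => M; near=> n; apply: (@le_trans _ _ n%:R).
    by near: n; exact: nbhs_infty_ger.
  by rewrite ler_nat -addn2 leq_addr.
move/cvg_at_rightP : F0 => /(_ (fun n => n.+2%:R^-1)); apply; split.
  by move=> n; rewrite invr_gt0.
apply/cvgrPdist_lt => e e0; near=> n.
rewrite sub0r normrN gtr0_norm ?invr_gt0// invf_plt ?posrE//.
apply: (@le_lt_trans _ _ n%:R); last by rewrite ltr_nat -addn2 -addSnnS leq_addr.
by near: n; exact: nbhs_infty_ger.
Unshelve. all: by end_near. Qed.

(** The endpoints enter as limits of [F] because [f] may be unbounded at 0. For [f >= 0], monotone
    convergence along [E] identifies the integral with the finite number [l1 - l0], so integrability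
    is a conclusion. *)
Lemma ge0_integrable_FTC_itv0y :
  (forall x : R, 0 < x -> 0 <= f x) -> mu.-integrable `]0, +oo[ (EFin \o f).
Proof.
move=> f0; apply/integrableP; split.
  apply/measurable_EFinP; exact: measurable_itv0y_continuous.
under eq_integral => x xD.
  have x0 : 0 < x by move: xD; rewrite inE/= in_itv/= andbT.
  by rewrite /= ger0_norm ?f0//; over.
have := @ge0_nondecreasing_set_cvg_integral _ (measurableTypeR R) R E (EFin \o f) mu ndE.
rewrite bigcupE => /(_ _ _ _) h.
have {h} : (\int[mu]_(x in E n) (f x)%:E)%E @[n --> \oo] -->
    (\int[mu]_(x in `]0%R, +oo[) (f x)%:E)%E.
  apply: h.
  - by move=> n; exact: measurable_itv.
  - move=> n; apply: measurable_funS (@E_pos n) _ => //.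
    apply/measurable_EFinP; exact: measurable_itv0y_continuous.
  - by move=> n x /E_pos/=; rewrite in_itv/= andbT lee_fin => /f0.
move=> h; have {h} : (F n.+2%:R - F n.+2%:R^-1)%:E @[n --> \oo] -->
    (\int[mu]_(x in `]0%R, +oo[) (f x)%:E)%E.
  move: h; rewrite -cvg_shiftS; apply: cvg_trans; apply: near_eq_cvg.
  by apply: nearW => n; exact: integral_E.
move=> /cvg_lim <-//.
suff /cvg_lim -> : (F n.+2%:R - F n.+2%:R^-1)%:E @[n --> \oo] --> (l1 - l0)%:E.
- by rewrite ltry.
- by [].
- by apply: cvg_EFin; [exact: nearW|exact: cvgF].
Qed.

(** Oscillating integrands change sign, so monotone convergence gives way to dominated convergence
    of the restrictions of [f] to [E], with bound [|f|]. *)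
Lemma Rintegral_FTC_itv0y : mu.-integrable `]0, +oo[ (EFin \o f) ->
  \int[mu]_(x in `]0, +oo[) f x = l1 - l0.
Proof.
move=> intf.
have mE n : measurable (E n) by exact: measurable_itv.
have [|||||_ h] := @Rintegral_dominated_cvg _ _ _ mu `]0, +oo[%classic
  (fun n => f \_ (E n.+1)) f (fun x => `|f x|).
- exact: measurable_itv.
- move=> n; apply/measurable_restrict => //; first exact: measurable_itv.
  apply: measurable_funS (measurable_itv0y_continuous cf) => //.
- move=> x /=; rewrite in_itv/= andbT => x0.
  apply: cvg_near_cst.
  have [n _ En] := nearE x0; exists n => // m /= nm.
  by rewrite patchE ifT// inE; apply: En => /=; rewrite leqW.
- exact: integrable_norm.
- move=> n x x0 /=; rewrite patchE; case: ifPn => // _.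
  by rewrite normr0.
have : (F n.+2%:R - F n.+2%:R^-1) @[n --> \oo] --> \int[mu]_(x in `]0, +oo[) f x.
  apply: cvg_trans h; apply: near_eq_cvg; apply: nearW => n /=.
  rewrite -[RHS]/(fine (_%:E)) -integral_E -Rintegral_mkcondr setIidr//.
move=> h'; apply: (cvg_unique _ h' cvgF) => //.
Qed.

End FTC_itv0y.

(** * Fourier transforms of gamma densities *)

Section derive_rules.
Context {R : realType}.
Implicit Types (f g : R -> R) (x k : R).

Lemma is_derive_continuous f x l : is_derive x 1 f l -> {for x, continuous f}.
Proof.
move=> [df _]; apply: differentiable_continuous; exact/derivable1_diffP.
Qed.

Lemma is_derive_mul f g x df dg : is_derive x 1 f df -> is_derive x 1 g dg ->
  is_derive x 1 (fun y => f y * g y) (df * g x + f x * dg).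
Proof.
by move=> hf hg; apply: is_derive_eq; rewrite /GRing.scale/= addrC (mulrC df).
Qed.

Lemma is_derive_add f g x df dg : is_derive x 1 f df -> is_derive x 1 g dg ->
  is_derive x 1 (fun y => f y + g y) (df + dg).
Proof. by move=> hf hg; apply: is_derive_eq. Qed.

Lemma is_derive_opp f x df : is_derive x 1 f df ->
  is_derive x 1 (fun y => - f y) (- df).
Proof. by move=> hf; apply: is_derive_eq. Qed.

Lemma is_derive_scal f x k df : is_derive x 1 f df ->
  is_derive x 1 (fun y => k * f y) (k * df).
Proof.
move=> hf; apply: (is_derive_eq (is_derive_mul (is_derive_cst k x 1) hf)).
by rewrite mul0r add0r.
Qed.

Lemma is_derive_comp f g x df dg : is_derive (g x) 1 f df -> is_derive x 1 g dg ->
  is_derive x 1 (fun y => f (g y)) (df * dg).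
Proof. by move=> hf hg; apply: is_derive_eq; rewrite mulrC. Qed.

Lemma is_derive_scalid x k : is_derive x 1 (fun y => k * y) k.
Proof.
apply: (is_derive_eq (is_derive_scal k (is_derive_id x 1))); exact: mulr1.
Qed.

End derive_rules.

Section gamma_integrals.
Context {R : realType}.
Notation mu := (@lebesgue_measure R).
Implicit Types (s r t x : R).

(** The gamma density of shape [s] and rate [r], up to its constant. *)
Definition gamma_weight s r x : R := x `^ (s - 1) * expR (- (r * x)).

Lemma gamma_weight_ge0 s r x : 0 <= gamma_weight s r x.
Proof. by rewrite mulr_ge0 ?powR_ge0 ?expR_ge0. Qed.

Lemma gamma_weightS s r x : 0 < x -> gamma_weight (s + 1) r x = x * gamma_weight s r x.
Proof.
move=> x0; rewrite /gamma_weight mulrA; congr (_ * _).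
rewrite -[X in X * _](powRr1 (ltW x0)) -powRD; first by congr (_ `^ _); ring.
by rewrite (gt_eqF x0) implybT.
Qed.

Lemma is_derive_gamma_weight s r x : 0 < x ->
  is_derive x 1 (gamma_weight (s + 1) r)
    (s * gamma_weight s r x - r * gamma_weight (s + 1) r x).
Proof.
move=> x0; have dp := is_derive1_powR (s + 1 - 1) x0.
have de := is_derive_comp (is_derive_expR _) (is_derive_opp (is_derive_scalid x r)).
apply: (is_derive_eq (is_derive_mul dp de)).
by rewrite /gamma_weight addrK; ring.
Qed.

Lemma continuous_gamma_weight s r x : 0 < x -> {for x, continuous (gamma_weight s r)}.
Proof.
move=> x0; rewrite -(subrK 1 s).
exact: is_derive_continuous (is_derive_gamma_weight _ _ x0).
Qed.

Lemma cvgy_powR s : 0 < s -> x `^ s @[x --> +oo%R] --> +oo%R.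
Proof.
move=> s0; apply/cvgryPge => M; near=> x.
have Mx : Num.max M 0 <= x by near: x; apply: nbhs_pinfty_ge; exact: num_real.
have M0 : 0 <= Num.max M 0 by rewrite le_max lexx orbT.
apply: (@le_trans _ _ ((Num.max M 0) `^ s^-1 `^ s)).
  by rewrite -powRrM mulVf ?gt_eqF// powRr1 ?le_max ?lexx ?orbT.
apply: ge0_ler_powR; rewrite ?nnegrE ?powR_ge0 ?(ltW s0)//.
Unshelve. all: by end_near. Qed.

Lemma powR_le_expR s r : 0 < s -> 0 < r ->
  exists2 C, 0 < C & forall x, 0 < x -> x `^ s <= C * expR (r * x).
Proof.
(* The constant is [(s / r)^s]: after taking logarithms the claim is [s ln y <= s y] at
   [y = r x / s], which follows from [1 + ln y <= y]. *)
move=> s0 r0; exists (expR (- (s * ln (r / s)))); first exact: expR_gt0.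
move=> x x0; rewrite -expRD /powR gt_eqF// ler_expR -lerBlDl opprK -mulrDr addrC.
rewrite -lnM ?posrE ?divr_gt0//.
have := expR_ge1Dx (ln (r / s * x)); rewrite lnK ?posrE ?mulr_gt0 ?invr_gt0// => h.
have -> : r * x = s * (r / s * x) by field; rewrite gt_eqF.
by rewrite ler_pM2l//; apply: le_trans h; rewrite lerDr.
Qed.

(* The integrand is dominated by a multiple of the derivative of the bounded
   function [atan (x `^ s)]. *)
Lemma integrable_gamma_weight s r : 0 < s -> 0 < r ->
  mu.-integrable `]0, +oo[ (EFin \o gamma_weight s r).
Proof.
move=> s0 r0.
pose f x : R := s * x `^ (s - 1) / (1 + (x `^ s) ^+ 2).
have dF x : 0 < x -> is_derive x 1 (fun x => atan (x `^ s)) (f x).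
  move=> x0; apply: (is_derive_eq (is_derive_comp (is_derive1_atan _)
    (is_derive1_powR s x0))).
  by rewrite mulrC.
have den x : 0 < 1 + (x `^ s) ^+ 2 by rewrite ltr_pwDl// sqr_ge0.
have cf x : 0 < x -> {for x, continuous f}.
  move=> x0; apply: cvgM; first apply: cvgM; first exact: cvg_cst.
    exact: is_derive_continuous (is_derive1_powR (s - 1) x0).
  apply: cvgV; first by rewrite gt_eqF.
  apply: cvgD; first exact: cvg_cst.
  have c := is_derive_continuous (is_derive1_powR s x0).
  rewrite expr2; under eq_fun do rewrite expr2; exact: cvgM.
have intf : mu.-integrable `]0, +oo[ (EFin \o f).
  apply: (@ge0_integrable_FTC_itv0y R (fun x => atan (x `^ s)) f (atan 0) (pi / 2)) => //.
  - by apply: continuous_cvg; [exact: continuous_atan|exact: powR_cvg0].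
  - by apply: cvg_comp; [exact: cvgy_powR|exact: cvgy_atan].
  - move=> x x0; rewrite divr_ge0 ?(ltW (den x))// mulr_ge0 ?(ltW s0)//.
    exact: powR_ge0.
(* This gives [(1 + x^(2 s)) exp (- r x) <= 1 + C]; dividing by the factor [s] in [f] yields the
   multiple [(1 + C) / s]. *)
have [C C0 hC] : exists2 C, 0 < C & forall x, 0 < x -> x `^ (s + s) <= C * expR (r * x).
  by apply: powR_le_expR => //; rewrite addr_gt0.
have mD := @measurable_itv0y R.
apply: (le_Rintegrable mD _ _ (RintegrableZl mD ((1 + C) / s) intf)).
- by apply: measurable_itv0y_continuous; exact: continuous_gamma_weight.
- move=> x /=; rewrite in_itv/= andbT => x0.
  rewrite ger0_norm ?gamma_weight_ge0// /f.
  have -> : (1 + C) / s * (s * x `^ (s - 1) / (1 + (x `^ s) ^+ 2)) =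
      x `^ (s - 1) * ((1 + C) / (1 + (x `^ s) ^+ 2)).
    by field; rewrite gt_eqF ?den// gt_eqF.
  rewrite ler_wpM2l ?powR_ge0// ler_pdivlMr ?den// expRN mulrC.
  rewrite ler_pdivrMr ?expR_gt0//.
  have -> : (x `^ s) ^+ 2 = x `^ (s + s).
    by rewrite powRD ?expr2// (gt_eqF x0) implybT.
  rewrite mulrDl mul1r lerD ?hC//.
  by rewrite -expR0 ler_expR mulr_ge0// ltW.
Qed.

Lemma cvg_at_right_gamma_weight s r (h : R -> R) : 0 < s -> 0 <= r ->
  (forall x, `|h x| <= 1) -> gamma_weight (s + 1) r x * h x @[x --> 0^'+] --> (0 : R).
Proof.
move=> s0 r0 h1; apply: norm_cvg0; apply: (@squeeze_cvgr _ _ _ _ (cst 0) (@powR R ^~ s)).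
- near=> x; rewrite normr_ge0/= normrM ger0_norm ?gamma_weight_ge0//.
  rewrite /gamma_weight addrK -mulrA ler_piMr ?powR_ge0//.
  rewrite -[leRHS]mul1r ler_pM ?expR_ge0// -expR0 ler_expR oppr_le0 mulr_ge0//.
- exact: cvg_cst.
- exact: powR_cvg0.
Unshelve. all: by end_near. Qed.

Lemma cvgy_expRN r : 0 < r -> expR (- (r * x)) @[x --> +oo] --> (0 : R).
Proof.
move=> r0; apply: (@cvg_comp _ _ _ (fun x => r * x) (fun x => expR (- x))).
  by apply: gt0_cvgMry => //; exact: cvg_id.
exact: cvgr_expR.
Qed.

Lemma cvgy_gamma_weight s r (h : R -> R) : 0 < s -> 0 < r ->
  (forall x, `|h x| <= 1) -> gamma_weight (s + 1) r x * h x @[x --> +oo] --> (0 : R).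
Proof.
(* Half of the rate absorbs the power [x^s]; the other half provides the decay. *)
move=> s0 r0 h1; have r20 : 0 < r / 2 by rewrite divr_gt0.
have [C C0 hC] := powR_le_expR s0 r20.
apply: norm_cvg0.
apply: (@squeeze_cvgr _ _ _ _ (cst 0) (fun x => C * expR (- (r / 2 * x)))).
- near=> x; have x0 : 0 < x by near: x; exact: nbhs_pinfty_gt.
  rewrite normr_ge0/= normrM ger0_norm ?gamma_weight_ge0// /gamma_weight addrK.
  rewrite -[leRHS]mulr1 ler_pM ?mulr_ge0 ?powR_ge0 ?expR_ge0//.
  have -> : - (r * x) = - (r / 2 * x) + - (r / 2 * x) by field.
  rewrite expRD mulrA ler_wpM2r ?expR_ge0// expRN ler_pdivrMr ?expR_gt0//.
  exact: hC.
- exact: cvg_cst.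
- by rewrite -(mulr0 C); apply: cvgM; [exact: cvg_cst|exact: cvgy_expRN].
Unshelve. all: by end_near. Qed.

(** Together with [gamma_sin], the real and imaginary parts of [Gamma s (r - i t)^(- s)] when [s]
    and [r] are positive. *)
Definition gamma_cos s r t : R :=
  \int[mu]_(x in `]0, +oo[) (gamma_weight s r x * cos (t * x)).
Definition gamma_sin s r t : R :=
  \int[mu]_(x in `]0, +oo[) (gamma_weight s r x * sin (t * x)).

Lemma normr_cos_le1 x : `|cos x| <= 1.
Proof. by rewrite ler_norml cos_geN1 cos_le1. Qed.

Lemma normr_sin_le1 x : `|sin x| <= 1.
Proof. by rewrite ler_norml sin_geN1 sin_le1. Qed.

Lemma measurable_cos_scal (D : set R) t : measurable_fun D (fun x => cos (t * x)).
Proof.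
apply: measurable_funTS; apply: continuous_measurable_fun => x.
exact: is_derive_continuous (is_derive_comp (is_derive_cos _) (is_derive_scalid x t)).
Qed.

Lemma measurable_sin_scal (D : set R) t : measurable_fun D (fun x => sin (t * x)).
Proof.
apply: measurable_funTS; apply: continuous_measurable_fun => x.
exact: is_derive_continuous (is_derive_comp (is_derive_sin _) (is_derive_scalid x t)).
Qed.

(* With [m s = gamma_cos s + i gamma_sin s], the next two lemmas are the real and
   imaginary parts of [s * m s = (r - i t) * m (s + 1)]. *)
Lemma gamma_cosS s r t : 0 < s -> 0 < r ->
  s * gamma_cos s r t = r * gamma_cos (s + 1) r t + t * gamma_sin (s + 1) r t.
Proof.
move=> s0 r0; have s10 : 0 < s + 1 by rewrite addr_gt0.
have mD := @measurable_itv0y R.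
have i0 := RintegrableM_le1 mD (integrable_gamma_weight s0 r0)
  (measurable_cos_scal t) (fun x => normr_cos_le1 _).
have i1 := RintegrableM_le1 mD (integrable_gamma_weight s10 r0)
  (measurable_cos_scal t) (fun x => normr_cos_le1 _).
have i2 := RintegrableM_le1 mD (integrable_gamma_weight s10 r0)
  (measurable_sin_scal t) (fun x => normr_sin_le1 _).
have j0 := RintegrableZl mD s i0.
have j1 := RintegrableZl mD r i1.
have j2 := RintegrableZl mD t i2.
have j01 := RintegrableB mD j0 j1.
have := @Rintegral_FTC_itv0y R (fun x => gamma_weight (s + 1) r x * cos (t * x))
  (fun x => s * (gamma_weight s r x * cos (t * x)) -
     r * (gamma_weight (s + 1) r x * cos (t * x)) -
     t * (gamma_weight (s + 1) r x * sin (t * x))) 0 0.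
rewrite subrr => /(_ _ _ _ _ (RintegrableB mD j01 j2)) h.
rewrite /gamma_cos /gamma_sin -!RintegralZl//.
apply/eqP; rewrite -subr_eq0 opprD addrA -!RintegralB//; apply/eqP/h.
- move=> x x0.
  apply: (is_derive_eq (is_derive_mul (is_derive_gamma_weight s r x0)
    (is_derive_comp (is_derive_cos _) (is_derive_scalid x t)))).
  ring.
- move=> x x0; have c0 := @continuous_gamma_weight s r _ x0.
  have c1 := @continuous_gamma_weight (s + 1) r _ x0.
  have c2 := is_derive_continuous (is_derive_comp (is_derive_cos _) (is_derive_scalid x t)).
  have c3 := is_derive_continuous (is_derive_comp (is_derive_sin _) (is_derive_scalid x t)).
  by apply: cvgB; [apply: cvgB|]; (apply: cvgM; [exact: cvg_cst|exact: cvgM]).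
- apply: cvg_at_right_gamma_weight => //; first exact: ltW.
  by move=> x; exact: normr_cos_le1.
- by apply: cvgy_gamma_weight => // x; rewrite normr_cos_le1.
Qed.

Lemma gamma_sinS s r t : 0 < s -> 0 < r ->
  s * gamma_sin s r t = r * gamma_sin (s + 1) r t - t * gamma_cos (s + 1) r t.
Proof.
move=> s0 r0; have s10 : 0 < s + 1 by rewrite addr_gt0.
have mD := @measurable_itv0y R.
have i0 := RintegrableM_le1 mD (integrable_gamma_weight s0 r0)
  (measurable_sin_scal t) (fun x => normr_sin_le1 _).
have i1 := RintegrableM_le1 mD (integrable_gamma_weight s10 r0)
  (measurable_cos_scal t) (fun x => normr_cos_le1 _).
have i2 := RintegrableM_le1 mD (integrable_gamma_weight s10 r0)
  (measurable_sin_scal t) (fun x => normr_sin_le1 _).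
have j0 := RintegrableZl mD s i0.
have j1 := RintegrableZl mD r i2.
have j2 := RintegrableZl mD t i1.
have j01 := RintegrableB mD j0 j1.
have := @Rintegral_FTC_itv0y R (fun x => gamma_weight (s + 1) r x * sin (t * x))
  (fun x => s * (gamma_weight s r x * sin (t * x)) -
     r * (gamma_weight (s + 1) r x * sin (t * x)) +
     t * (gamma_weight (s + 1) r x * cos (t * x))) 0 0.
rewrite subrr => /(_ _ _ _ _ (RintegrableD mD j01 j2)) h.
rewrite /gamma_cos /gamma_sin -!RintegralZl//.
apply/eqP; rewrite -subr_eq0 opprD opprK addrA -RintegralB// -RintegralD//; apply/eqP/h.
- move=> x x0.
  apply: (is_derive_eq (is_derive_mul (is_derive_gamma_weight s r x0)
    (is_derive_comp (is_derive_sin _) (is_derive_scalid x t)))).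
  ring.
- move=> x x0; have c0 := @continuous_gamma_weight s r _ x0.
  have c1 := @continuous_gamma_weight (s + 1) r _ x0.
  have c2 := is_derive_continuous (is_derive_comp (is_derive_cos _) (is_derive_scalid x t)).
  have c3 := is_derive_continuous (is_derive_comp (is_derive_sin _) (is_derive_scalid x t)).
  by apply: cvgD; [apply: cvgB|]; (apply: cvgM; [exact: cvg_cst|exact: cvgM]).
- apply: cvg_at_right_gamma_weight => //; first exact: ltW.
  by move=> x; exact: normr_sin_le1.
- by apply: cvgy_gamma_weight => // x; rewrite normr_sin_le1.
Qed.

End gamma_integrals.

(** * The Bessel series *)

Lemma Rintegral_sum_ord d (T : measurableType d) (R : realType)
    (mu : {measure set T -> \bar R}) (D : set T) (f : nat -> T -> R) n :
  measurable D -> (forall k, mu.-integrable D (EFin \o f k)) ->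
  mu.-integrable D (EFin \o (fun x => \sum_(k < n) f k x)) /\
  \int[mu]_(x in D) (\sum_(k < n) f k x) = \sum_(k < n) \int[mu]_(x in D) f k x.
Proof.
move=> mD intf; elim: n => [|n [IHi IHn]].
  split; last first.
    by rewrite big_ord0; under eq_Rintegral do rewrite big_ord0; rewrite Rintegral_cst ?mul0r.
  rewrite (_ : _ \o _ = cst 0%E); first exact: integrable0.
  by apply/funext => x /=; rewrite big_ord0.
split.
  rewrite (_ : _ \o _ = EFin \o (fun x => \sum_(k < n) f k x + f n x)).
    exact: RintegrableD.
  by apply/funext => x /=; rewrite big_ord_recr.
under eq_Rintegral do rewrite big_ord_recr/=.
by rewrite RintegralD// IHn big_ord_recr.
Qed.

(** * Positivity and functional equation of the Gamma function *)

Section Gamma_function.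
Context {R : realType}.
Notation mu := (@lebesgue_measure R).
Implicit Types x : R.

(** A zero integral would force [f = 0] almost everywhere, placing the half line, of infinite
    measure, inside a null set. *)
Lemma Rintegral_itv0y_gt0 (f : R -> R) : mu.-integrable `]0, +oo[ (EFin \o f) ->
  (forall x, 0 < x -> 0 < f x) -> 0 < \int[mu]_(x in `]0, +oo[) f x.
Proof.
move=> intf f0.
have f_ge0 : 0 <= \int[mu]_(x in `]0, +oo[) f x.
  by apply: Rintegral_ge0 => x /=; rewrite in_itv/= andbT => /f0/ltW.
rewrite lt_neqAle f_ge0 andbT eq_sym; apply/negP => /eqP if0.
have : (\int[mu]_(x in `]0%R, +oo[) `|(f x)%:E| = 0)%E.
  under eq_integral => x xD.
    have x0 : 0 < x by move: xD; rewrite inE/= in_itv/= andbT.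
    by rewrite /= ger0_norm ?(ltW (f0 _ x0))//; over.
  rewrite -[LHS]fineK; first by rewrite -/(Rintegral _ _ _) if0.
  exact: integrable_fin_num.
move/ae_eq_integral_abs => /(_ (@measurable_itv0y R) (measurable_int _ intf)).
move=> [A [mA A0 sA]].
have : (mu `]0%R, +oo[ <= mu A)%E.
  apply: le_measure; rewrite ?inE; [exact: measurable_itv0y|exact: mA|].
  move=> x x0; apply: sA => /= /(_ x0) [fx0].
  by move: x0; rewrite /= in_itv/= andbT => /f0; rewrite fx0 ltxx.
by rewrite A0 lebesgue_measure_itv/= ltry addye.
Qed.

(** At [t = 0] and rate 1 the integration by parts done for [gamma_cos] becomes Euler's functional
    equation. *)
Lemma GammaE x : Gamma x = gamma_cos x 1 0.
Proof.
by apply: eq_Rintegral => t _; rewrite /gamma_weight mul0r cos0 mulr1 mul1r.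
Qed.

Lemma GammaS x : 0 < x -> Gamma (x + 1) = x * Gamma x.
Proof. by move=> x0; rewrite !GammaE gamma_cosS// mul0r addr0 mul1r. Qed.

Lemma Gamma_gt0 x : 0 < x -> 0 < Gamma x.
Proof.
move=> x0; have h := @integrable_gamma_weight R x 1 x0 ltr01.
rewrite /Gamma (@eq_Rintegral _ _ _ mu _ (gamma_weight x 1)); last first.
  by move=> t _; rewrite /gamma_weight mul1r.
apply: Rintegral_itv0y_gt0 => // t t0.
by rewrite mulr_gt0 ?expR_gt0// powR_gt0.
Qed.

End Gamma_function.

Section mckay_series.
Context {R : realType}.
Notation mu := (@lebesgue_measure R).
Variables a b c : R.
Hypothesis a_gt : - (1 / 2) < a.
Hypothesis b_gt0 : 0 < b.
Hypothesis c_gt1 : 1 < c.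
Implicit Types x t : R.

(** The coefficient of [x^(2 k + a)] in the expansion of [besselI a (x / b)]. *)
Definition bessel_coef (k : nat) : R :=
  (2 * b)^-1 `^ (k.*2%:R + a) / (k`!%:R * Gamma (k%:R + a + 1)).

(* [gamma_weight (bessel_shape k) r] is the power [x `^ (2 k + 2 a)] times [expR (- r x)]. *)
Definition bessel_shape (k : nat) : R := k.*2%:R + (2 * a + 1).

Definition mckay_partial (n : nat) x : R :=
  \sum_(k < n) bessel_coef k * gamma_weight (bessel_shape k) (c / b) x.

Lemma Gamma_arg_gt0 (k : nat) : 0 < k%:R + a + 1.
Proof. by have := ler0n R k; move: a_gt; lra. Qed.

Lemma bessel_shape_gt0 k : 0 < bessel_shape k.
Proof. by rewrite /bessel_shape; have := ler0n R k.*2; move: a_gt; lra. Qed.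

Lemma mckay_rate_gt0 : 0 < c / b.
Proof. by rewrite divr_gt0// (lt_trans _ c_gt1). Qed.

Lemma bessel_coef_gt0 k : 0 < bessel_coef k.
Proof.
rewrite divr_gt0 ?powR_gt0 ?invr_gt0 ?mulr_gt0 ?ltr0n ?fact_gt0//.
exact/Gamma_gt0/Gamma_arg_gt0.
Qed.

(** Bessel's equation read on coefficients. The factor [4 (k + 1) (k + a + 1)] is split as
    [2 (k + 1)] times [bessel_shape k + 1], since the second factor is the one produced by
    integrating by parts a gamma weight of shape [bessel_shape k + 2]. *)
Lemma bessel_coefS k :
  (k.+1).*2%:R * (bessel_shape k + 1) * bessel_coef k.+1 = b^-1 ^+ 2 * bessel_coef k.
Proof.
have G1 := GammaS (Gamma_arg_gt0 k).
have G0 := Gamma_gt0 (Gamma_arg_gt0 k).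
rewrite /bessel_coef doubleS (_ : k.+1%:R + a + 1 = k%:R + a + 1 + 1); last first.
  by rewrite -addn1 natrD; ring.
rewrite G1 factS natrM.
rewrite (_ : k.*2.+2%:R + a = (k.*2%:R + a) + 2%:R); last first.
  by rewrite -addn2 natrD; ring.
have b20 : 0 < (2 * b)^-1 by rewrite invr_gt0 mulr_gt0.
rewrite powRD; last by rewrite (gt_eqF b20) implybT.
rewrite powR_mulrn ?invr_ge0 ?mulr_ge0 ?(ltW b_gt0)//.
have f0 : k`!%:R != 0 :> R by rewrite pnatr_eq0 -lt0n fact_gt0.
have k0 : k.+1%:R != 0 :> R by rewrite pnatr_eq0.
have -> : k.*2.+2%:R = 2 * k.+1%:R :> R by rewrite -natrM mul2n.
rewrite /bessel_shape (_ : k.*2%:R = 2 * k%:R :> R); last by rewrite -mul2n natrM.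
have ka := Gamma_arg_gt0 k.
have kE : k.+1%:R = k%:R + 1 :> R by rewrite -addn1 natrD.
rewrite kE in k0 *.
field.
by rewrite f0 k0 !gt_eqF.
Qed.

Lemma mckay_partialE n x : 0 < x ->
  mckay_partial n x = x `^ a * expR (- (x * c / b)) *
    series (fun k : nat => (x / b / 2) `^ (k.*2%:R + a) /
                           (k`!%:R * Gamma (k%:R + a + 1))) n.
Proof.
move=> x0; rewrite /series/= big_mkord mulr_sumr; apply: eq_bigr => k _.
rewrite /bessel_coef /gamma_weight.
have -> : x / b / 2 = x * (2 * b)^-1 by field; rewrite gt_eqF.
rewrite powRM ?(ltW x0) ?invr_ge0 ?mulr_ge0 ?(ltW b_gt0)//.
rewrite (_ : bessel_shape k - 1 = a + (k.*2%:R + a)); last first.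
  by rewrite /bessel_shape; ring.
rewrite [X in X * expR _]powRD; last by rewrite (gt_eqF x0) implybT.
rewrite (_ : c / b * x = x * c / b); last by ring.
by ring.
Qed.

(* Compares the Bessel series with the exponential series, which is the case
   [a = - 1 / 2]. *)
Lemma bessel_fact_le k :
  (k.*2)`!%:R * Gamma (a + 1) <= 4 ^+ k * k`!%:R * Gamma (k%:R + a + 1).
Proof.
elim: k => [|k IH]; first by rewrite double0 fact0 expr0 add0r !mul1r.
have G0 := Gamma_gt0 (Gamma_arg_gt0 k).
rewrite doubleS !factS !natrM (_ : k.+1%:R + a + 1 = k%:R + a + 1 + 1); last first.
  by rewrite -addn1 natrD; ring.
rewrite (GammaS (Gamma_arg_gt0 k)) exprS.
have -> : 4 * 4 ^+ k * (k.+1%:R * k`!%:R) * ((k%:R + a + 1) * Gamma (k%:R + a + 1)) =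
  (4 * k.+1%:R * (k%:R + a + 1)) * (4 ^+ k * k`!%:R * Gamma (k%:R + a + 1)) by ring.
have -> : k.*2.+2%:R * (k.*2.+1%:R * k.*2`!%:R) * Gamma (a + 1) =
  (k.*2.+2%:R * k.*2.+1%:R) * (k.*2`!%:R * Gamma (a + 1)) by ring.
have Ga : 0 <= Gamma (a + 1) by apply/ltW/Gamma_gt0; move: a_gt; lra.
apply: ler_pM; [exact: mulr_ge0|exact: mulr_ge0| |exact: IH].
have -> : k.*2.+2%:R = 2 * k.+1%:R :> R by rewrite -natrM mul2n.
have -> : k.*2.+1%:R = 2 * k%:R + 1 :> R by rewrite -mul2n -addn1 natrD natrM.
have -> : k.+1%:R = k%:R + 1 :> R by rewrite -addn1 natrD.
have := ler0n R k; rewrite -subr_ge0 => k0; rewrite -subr_ge0.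
have -> : 4 * (k%:R + 1) * (k%:R + a + 1) - 2 * (k%:R + 1) * (2 * k%:R + 1) = (k%:R + 1) * (4 * a + 2) by ring.
by rewrite mulr_ge0//; move: a_gt k0; lra.
Qed.

Lemma series_exp_coeff_le x n : 0 <= x -> series (exp_coeff x) n <= expR x.
Proof.
move=> x0; apply: nondecreasing_cvgn_le; last exact: is_cvg_series_exp_coeff.
by apply: nondecreasing_series => k _ _; exact: exp_coeff_ge0.
Qed.

(** These are partial sums of [cosh x]: the odd terms are dropped from the exponential sum of twice
    the length. *)
Lemma sum_even_exp_le x n : 0 <= x ->
  \sum_(k < n) x ^+ k.*2 / (k.*2)`!%:R <= expR x.
Proof.
move=> x0; apply: le_trans (series_exp_coeff_le n.*2 x0).
rewrite /series/=; elim: n => [|n IH]; first by rewrite big_ord0 big_nil.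
rewrite big_ord_recr/= doubleS !big_nat_recr//=.
by rewrite -[leLHS]addr0; apply: lerD; [exact: lerD|exact: exp_coeff_ge0].
Qed.

(** The value of [bessel_coef 0]. *)
Definition mckay_const : R := (2 * b)^-1 `^ a / Gamma (a + 1).

Lemma mckay_partial_ge0 n x : 0 <= mckay_partial n x.
Proof.
apply: sumr_ge0 => k _; apply: mulr_ge0; last exact: gamma_weight_ge0.
exact/ltW/bessel_coef_gt0.
Qed.

(** By [bessel_fact_le] the term of index [k] is at most the constant times
    [(x / b)^(2 k) / (2 k)!], the [4^k] cancelling the halves in the Bessel terms. The sum is then
    below [cosh (x / b) <= exp (x / b)], which lowers the rate from [c / b] to [(c - 1) / b], still
    positive when [1 < c]. *)
Lemma mckay_partial_le n x : 0 < x ->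
  mckay_partial n x <= mckay_const * gamma_weight (2 * a + 1) ((c - 1) / b) x.
Proof.
move=> x0.
have Ga : 0 < Gamma (a + 1) by apply/Gamma_gt0; move: a_gt; lra.
have b20 : 0 < (2 * b)^-1 by rewrite invr_gt0 mulr_gt0.
have hk k : bessel_coef k * gamma_weight (bessel_shape k) (c / b) x <=
    mckay_const * gamma_weight (2 * a + 1) (c / b) x * ((x / b) ^+ k.*2 / (k.*2)`!%:R).
  rewrite /bessel_coef /gamma_weight /mckay_const.
  rewrite (_ : bessel_shape k - 1 = 2 * a + 1 - 1 + k.*2%:R); last first.
    by rewrite /bessel_shape; ring.
  rewrite [x `^ _]powRD; last by rewrite (gt_eqF x0) implybT.
  rewrite (addrC k.*2%:R a) [(2 * b)^-1 `^ _]powRD; last by rewrite (gt_eqF b20) implybT.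
  rewrite !powR_mulrn ?(ltW x0) ?(ltW b20)//.
  set X := x `^ _; set B := _ `^ a; set E := expR _.
  have -> : B * (2 * b)^-1 ^+ k.*2 / (k`!%:R * Gamma (k%:R + a + 1)) * (X * x ^+ k.*2 * E) =
     B * X * E * (x / b) ^+ k.*2 * (4 ^+ k * k`!%:R * Gamma (k%:R + a + 1))^-1.
    have -> : 4 ^+ k = 2 ^+ k * 2 ^+ k :> R by rewrite -exprMn -natrM.
    rewrite -mul2n !exprM !exprMn !exprVn !exprMn; field.
    by rewrite !expf_neq0 ?gt_eqF ?Gamma_gt0 ?ltr0n ?fact_gt0 ?Gamma_arg_gt0.
  have -> : B / Gamma (a + 1) * (X * E) * ((x / b) ^+ k.*2 / k.*2`!%:R) =
     B * X * E * (x / b) ^+ k.*2 * (k.*2`!%:R * Gamma (a + 1))^-1.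
    by field; rewrite !gt_eqF ?ltr0n ?fact_gt0//.
  apply: ler_wpM2l.
    by rewrite !mulr_ge0 ?exprn_ge0 ?divr_ge0 ?powR_ge0 ?expR_ge0 ?ltW.
  have p k1 : 0 < k1`!%:R :> R by rewrite ltr0n fact_gt0.
  rewrite lef_pV2 ?posrE; [exact: bessel_fact_le| |exact: mulr_gt0].
  by rewrite mulr_gt0 ?Gamma_gt0 ?Gamma_arg_gt0// mulr_gt0 ?exprn_gt0.
apply: (le_trans (ler_sum _ (fun k _ => hk _))).
rewrite -mulr_sumr -mulrA ler_wpM2l//.
  by rewrite divr_ge0 ?powR_ge0// ltW.
rewrite /gamma_weight -[leLHS]mulrA; apply: ler_wpM2l; first exact: powR_ge0.
have -> : - ((c - 1) / b * x) = - (c / b * x) + x / b by ring.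
rewrite expRD; apply: ler_wpM2l; first exact: expR_ge0.
by apply: sum_even_exp_le; rewrite divr_ge0 ?ltW.
Qed.

(** The function [besselI] is a [limn], which carries information only once the series converges.
    Its terms are nonnegative, and the preceding bound, divided by the prefactor, bounds its partial
    sums. *)
Lemma cvg_mckay_partial x : 0 < x ->
  mckay_partial n x @[n --> \oo] --> mckayI_kernel a b c x.
Proof.
move=> x0; under eq_cvg do rewrite mckay_partialE//.
apply: cvgM; first exact: cvg_cst.
have p0 : 0 < x `^ a * expR (- (x * c / b)) by rewrite mulr_gt0 ?powR_gt0 ?expR_gt0.
apply: nondecreasing_is_cvgn.
  apply: nondecreasing_series => k _ _; apply: divr_ge0; first exact: powR_ge0.
  by apply: mulr_ge0; [exact: ler0n|exact/ltW/Gamma_gt0/Gamma_arg_gt0].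
exists (mckay_const * gamma_weight (2 * a + 1) ((c - 1) / b) x /
        (x `^ a * expR (- (x * c / b)))) => _ [n _ <-].
by rewrite ler_pdivlMr// mulrC -mckay_partialE// mckay_partial_le.
Qed.

End mckay_series.

(** * The differential equation of the McKay characteristic function *)

Section mckay_integrals.
Context {R : realType}.
Notation mu := (@lebesgue_measure R).
Variables a b c : R.
Hypothesis a_gt : - (1 / 2) < a.
Hypothesis b_gt0 : 0 < b.
Hypothesis c_gt1 : 1 < c.
Implicit Types x t : R.

Local Notation K := (mckayI_kernel a b c).
Local Notation K_ := (mckay_partial a b c).
Local Notation r := (c / b).
Local Notation u_ := (bessel_coef a b).
Local Notation s_ := (bessel_shape a).
Local Notation bound := (fun x => mckay_const a b * gamma_weight (2 * a + 1) ((c - 1) / b) x).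

Let mD := @measurable_itv0y R.

Lemma measurable_mckay_partial n :
  measurable_fun (`]0, +oo[ : set R) (K_ n).
Proof.
apply: measurable_sum => k; apply: measurable_funM; first exact: measurable_cst.
by apply: measurable_itv0y_continuous; exact: continuous_gamma_weight.
Qed.

(** The factor [p] is kept general because the exchange of limit and integral is needed twice: with
    a bounded [h] for the transform and with [x h] for its derivative. *)
Lemma cvg_mckay_integral (p g : R -> R) :
  measurable_fun (`]0, +oo[ : set R) p -> mu.-integrable `]0, +oo[ (EFin \o g) ->
  (forall x, 0 < x -> bound x * `|p x| <= g x) ->
  mu.-integrable `]0, +oo[ (EFin \o (fun x => K x * p x)) /\
  \int[mu]_(x in `]0, +oo[) (K_ n x * p x) @[n --> \oo] -->
    \int[mu]_(x in `]0, +oo[) (K x * p x).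
Proof.
move=> mp intg pg; apply: (Rintegral_dominated_cvg mD _ _ intg).
- by move=> n; apply: measurable_funM => //; exact: measurable_mckay_partial.
- move=> x /=; rewrite in_itv/= andbT => x0; apply: cvgM; last exact: cvg_cst.
  exact: cvg_mckay_partial.
- move=> n x /=; rewrite in_itv/= andbT => x0; apply: le_trans (pg _ x0).
  rewrite normrM ger0_norm; last exact: mckay_partial_ge0.
  by apply: ler_wpM2r => //; exact: mckay_partial_le.
Qed.

Lemma mckay_bound_ge0 x : 0 <= bound x.
Proof.
apply: mulr_ge0; last exact: gamma_weight_ge0.
apply: divr_ge0; first exact: powR_ge0.
by apply/ltW/Gamma_gt0; move: a_gt; lra.
Qed.

Lemma integrable_bound : mu.-integrable `]0, +oo[ (EFin \o bound).
Proof.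
apply: (RintegrableZl mD); apply: integrable_gamma_weight.
  by move: a_gt; lra.
by rewrite divr_gt0// subr_gt0.
Qed.

Lemma integrable_bound1 : mu.-integrable `]0, +oo[ (EFin \o (fun x => x * bound x)).
Proof.
have h : mu.-integrable `]0, +oo[
    (EFin \o (fun x => mckay_const a b * gamma_weight (2 * a + 1 + 1) ((c - 1) / b) x)).
  apply: (RintegrableZl mD); apply: integrable_gamma_weight.
    by move: a_gt; lra.
  by rewrite divr_gt0// subr_gt0.
apply: eq_integrable h; first exact: mD.
move=> x; rewrite inE/= in_itv/= andbT => x0; congr EFin.
by rewrite gamma_weightS// mulrCA.
Qed.

Variables (h : R -> R).
Hypothesis mh : measurable_fun (`]0, +oo[ : set R) h.
Hypothesis h_le1 : forall x, `|h x| <= 1.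

Lemma cvg_mckay_integral0 :
  mu.-integrable `]0, +oo[ (EFin \o (fun x => K x * h x)) /\
  \int[mu]_(x in `]0, +oo[) (K_ n x * h x) @[n --> \oo] -->
    \int[mu]_(x in `]0, +oo[) (K x * h x).
Proof.
apply: cvg_mckay_integral mh integrable_bound _ => x x0.
by apply: ler_piMr; [exact: mckay_bound_ge0|exact: h_le1].
Qed.

Lemma cvg_mckay_integral1 :
  mu.-integrable `]0, +oo[ (EFin \o (fun x => K x * (x * h x))) /\
  \int[mu]_(x in `]0, +oo[) (K_ n x * (x * h x)) @[n --> \oo] -->
    \int[mu]_(x in `]0, +oo[) (K x * (x * h x)).
Proof.
apply: cvg_mckay_integral integrable_bound1 _ => [|x x0].
  by apply: measurable_funM.
rewrite normrM (ger0_norm (ltW x0)) mulrCA; apply: ler_wpM2l; first exact: ltW.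
by apply: ler_piMr; [exact: mckay_bound_ge0|exact: h_le1].
Qed.

Let integrable_weight s : 0 < s ->
  mu.-integrable `]0, +oo[ (EFin \o (fun x => gamma_weight s r x * h x)).
Proof.
move=> s0; apply: (RintegrableM_le1 mD) => //.
by apply: integrable_gamma_weight => //; exact: mckay_rate_gt0.
Qed.

Lemma mckay_partial_integral0 n :
  \int[mu]_(x in `]0, +oo[) (K_ n x * h x) =
  \sum_(k < n) u_ k * \int[mu]_(x in `]0, +oo[) (gamma_weight (s_ k) r x * h x).
Proof.
have i0 k := integrable_weight (bessel_shape_gt0 a_gt k).
have i1 k := RintegrableZl mD (u_ k) (i0 k).
transitivity (\sum_(k < n)
    \int[mu]_(x in `]0, +oo[) (u_ k * (gamma_weight (s_ k) r x * h x))).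
  rewrite -(Rintegral_sum_ord n mD i1).2; apply: eq_Rintegral => x _.
  by rewrite mulr_suml; apply: eq_bigr => k _; rewrite mulrA.
apply: eq_bigr => k _; exact: RintegralZl.
Qed.

Lemma mckay_partial_integral1 n :
  \int[mu]_(x in `]0, +oo[) (K_ n x * (x * h x)) =
  \sum_(k < n) u_ k * \int[mu]_(x in `]0, +oo[) (gamma_weight (s_ k + 1) r x * h x).
Proof.
have i0 k := integrable_weight (ltr_wpDr ler01 (bessel_shape_gt0 a_gt k)).
have i1 k := RintegrableZl mD (u_ k) (i0 k).
transitivity (\sum_(k < n)
    \int[mu]_(x in `]0, +oo[) (u_ k * (gamma_weight (s_ k + 1) r x * h x))).
  rewrite -(Rintegral_sum_ord n mD i1).2; apply: eq_Rintegral => x.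
  rewrite inE/= in_itv/= andbT => x0.
  rewrite mulr_suml; apply: eq_bigr => k _.
  by rewrite gamma_weightS//; ring.
apply: eq_bigr => k _; exact: RintegralZl.
Qed.

End mckay_integrals.

Section mckay_charfun.
Context {R : realType}.
Notation mu := (@lebesgue_measure R).
Variables a b c : R.
Hypothesis a_gt : - (1 / 2) < a.
Hypothesis b_gt0 : 0 < b.
Hypothesis c_gt1 : 1 < c.
Implicit Types x t : R.

Local Notation K := (mckayI_kernel a b c).
Local Notation K_ := (mckay_partial a b c).
Local Notation r := (c / b).
Local Notation u_ := (bessel_coef a b).
Local Notation s_ := (bessel_shape a).

Definition mckay_cos t := \int[mu]_(x in `]0, +oo[) (K x * cos (t * x)).
Definition mckay_sin t := \int[mu]_(x in `]0, +oo[) (K x * sin (t * x)).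
Definition mckay_xcos t := \int[mu]_(x in `]0, +oo[) (K x * (x * cos (t * x))).
Definition mckay_xsin t := \int[mu]_(x in `]0, +oo[) (K x * (x * sin (t * x))).

Let r0 : 0 < r. Proof. exact: mckay_rate_gt0. Qed.

Let gcos (k : nat) t := gamma_cos (s_ k) r t.
Let gsin (k : nat) t := gamma_sin (s_ k) r t.
Let gcos1 (k : nat) t := gamma_cos (s_ k + 1) r t.
Let gsin1 (k : nat) t := gamma_sin (s_ k + 1) r t.

Let csum n t := \sum_(k < n) u_ k * gcos k t.
Let ssum n t := \sum_(k < n) u_ k * gsin k t.
Let csum1 n t := \sum_(k < n) u_ k * gcos1 k t.
Let ssum1 n t := \sum_(k < n) u_ k * gsin1 k t.

Let cvg_csum t : csum n t @[n --> \oo] --> mckay_cos t.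
Proof.
have [_] := cvg_mckay_integral0 a_gt b_gt0 c_gt1 (measurable_cos_scal t)
  (fun x => normr_cos_le1 (t * x)).
under eq_cvg do rewrite (mckay_partial_integral0 a_gt b_gt0 c_gt1 (measurable_cos_scal t)
  (fun x => normr_cos_le1 (t * x))).
exact.
Qed.

Let cvg_ssum t : ssum n t @[n --> \oo] --> mckay_sin t.
Proof.
have [_] := cvg_mckay_integral0 a_gt b_gt0 c_gt1 (measurable_sin_scal t)
  (fun x => normr_sin_le1 (t * x)).
under eq_cvg do rewrite (mckay_partial_integral0 a_gt b_gt0 c_gt1 (measurable_sin_scal t)
  (fun x => normr_sin_le1 (t * x))).
exact.
Qed.

Let cvg_csum1 t : csum1 n t @[n --> \oo] --> mckay_xcos t.
Proof.
have [_] := cvg_mckay_integral1 a_gt b_gt0 c_gt1 (measurable_cos_scal t)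
  (fun x => normr_cos_le1 (t * x)).
under eq_cvg do rewrite (mckay_partial_integral1 a_gt b_gt0 c_gt1 (measurable_cos_scal t)
  (fun x => normr_cos_le1 (t * x))).
exact.
Qed.

Let cvg_ssum1 t : ssum1 n t @[n --> \oo] --> mckay_xsin t.
Proof.
have [_] := cvg_mckay_integral1 a_gt b_gt0 c_gt1 (measurable_sin_scal t)
  (fun x => normr_sin_le1 (t * x)).
under eq_cvg do rewrite (mckay_partial_integral1 a_gt b_gt0 c_gt1 (measurable_sin_scal t)
  (fun x => normr_sin_le1 (t * x))).
exact.
Qed.

Let gcos_eq k t : s_ k * gcos k t = r * gcos1 k t + t * gsin1 k t.
Proof. exact/gamma_cosS/r0/bessel_shape_gt0. Qed.

Let gsin_eq k t : s_ k * gsin k t = r * gsin1 k t - t * gcos1 k t.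
Proof. exact/gamma_sinS/r0/bessel_shape_gt0. Qed.

(** Shapes advance by two, so two integrations by parts connect consecutive terms; the intermediate
    shape is that of the integrals with an extra factor [x]. *)
Let shapeS k : s_ k.+1 = s_ k + 1 + 1.
Proof. by rewrite /bessel_shape doubleS -addn2 natrD; ring. Qed.

Let gcos1_eq k t : (s_ k + 1) * gcos1 k t = r * gcos k.+1 t + t * gsin k.+1 t.
Proof.
rewrite /gcos /gsin shapeS; apply: gamma_cosS => //.
by rewrite ltr_wpDr// bessel_shape_gt0.
Qed.

Let gsin1_eq k t : (s_ k + 1) * gsin1 k t = r * gsin k.+1 t - t * gcos k.+1 t.
Proof.
rewrite /gcos /gsin shapeS; apply: gamma_sinS => //.
by rewrite ltr_wpDr// bessel_shape_gt0.
Qed.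

(** Writing [2 k = s_ k - (2 a + 1)] makes the weight [2 k] available to a first integration by
    parts. *)
Let dcsum n t : \sum_(k < n) k.*2%:R * u_ k * gcos k t =
  r * csum1 n t + t * ssum1 n t - (2 * a + 1) * csum n t.
Proof.
rewrite /csum1 /ssum1 /csum !mulr_sumr -big_split/= -sumrB; apply: eq_bigr => k _.
have := gcos_eq k t; rewrite /bessel_shape => e.
rewrite (_ : k.*2%:R * u_ k * gcos k t =
  u_ k * ((k.*2%:R + (2 * a + 1)) * gcos k t) - (2 * a + 1) * (u_ k * gcos k t)); last by ring.
by rewrite e; ring.
Qed.

Let dssum n t : \sum_(k < n) k.*2%:R * u_ k * gsin k t =
  r * ssum1 n t - t * csum1 n t - (2 * a + 1) * ssum n t.
Proof.
rewrite /csum1 /ssum1 /ssum !mulr_sumr -!sumrB; apply: eq_bigr => k _.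
have := gsin_eq k t; rewrite /bessel_shape => e.
rewrite (_ : k.*2%:R * u_ k * gsin k t =
  u_ k * ((k.*2%:R + (2 * a + 1)) * gsin k t) - (2 * a + 1) * (u_ k * gsin k t)); last by ring.
by rewrite e; ring.
Qed.

(** The term of index 0 vanishes through its factor [2 k]. After shifting the index, a second
    integration by parts and the recurrence of the coefficients turn each remaining term into one of
    [csum1], which therefore has one term fewer. *)
Let rec_cos n t :
  r * (\sum_(k < n.+1) k.*2%:R * u_ k * gcos k t) +
  t * (\sum_(k < n.+1) k.*2%:R * u_ k * gsin k t) = b^-1 ^+ 2 * csum1 n t.
Proof.
rewrite !big_ord_recl/= double0 !mul0r !add0r /csum1 !mulr_sumr -big_split/=.
apply: eq_bigr => k _; rewrite /bump/= add1n.
transitivity (k.+1.*2%:R * u_ k.+1 * (r * gcos k.+1 t + t * gsin k.+1 t)); first by ring.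
rewrite -gcos1_eq [RHS]mulrA -(bessel_coefS a_gt b_gt0); ring.
Qed.

Let rec_sin n t :
  r * (\sum_(k < n.+1) k.*2%:R * u_ k * gsin k t) -
  t * (\sum_(k < n.+1) k.*2%:R * u_ k * gcos k t) = b^-1 ^+ 2 * ssum1 n t.
Proof.
rewrite !big_ord_recl/= double0 !mul0r !add0r /ssum1 !mulr_sumr -sumrB.
apply: eq_bigr => k _; rewrite /bump/= add1n.
transitivity (k.+1.*2%:R * u_ k.+1 * (r * gsin k.+1 t - t * gcos k.+1 t)); first by ring.
rewrite -gsin1_eq [RHS]mulrA -(bessel_coefS a_gt b_gt0); ring.
Qed.

(* With [psi = mckay_cos + i mckay_sin] and [psi' = - mckay_xsin + i mckay_xcos], the
   next two lemmas are the differential equation for [psi]. The sums with factor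
   [2 k] are eliminated between the two recursions above before passing to the
   limit, so that their convergence is never needed. *)
Lemma mckay_xcos_eq t :
  (r ^+ 2 - t ^+ 2 - b^-1 ^+ 2) * mckay_xcos t + 2 * r * t * mckay_xsin t =
  (2 * a + 1) * (r * mckay_cos t + t * mckay_sin t).
Proof.
(* The recursion relates sums with [n.+1] terms to sums with [n] terms, so limits along both indices
   are needed. *)
have S (f : nat -> R) (l : R) : f n @[n --> \oo] --> l -> f n.+1 @[n --> \oo] --> l.
  by rewrite -[X in X -> _]cvg_shiftS.
have h1 : b^-1 ^+ 2 * csum1 n t @[n --> \oo] --> b^-1 ^+ 2 * mckay_xcos t.
  by apply: cvgMr; exact: cvg_csum1.
have cc := S _ _ (@cvg_csum t); have ss := S _ _ (@cvg_ssum t).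
have cc1 := S _ _ (@cvg_csum1 t); have ss1 := S _ _ (@cvg_ssum1 t).
have h2 : b^-1 ^+ 2 * csum1 n t @[n --> \oo] -->
  r * (r * mckay_xcos t + t * mckay_xsin t - (2 * a + 1) * mckay_cos t) +
  t * (r * mckay_xsin t - t * mckay_xcos t - (2 * a + 1) * mckay_sin t).
  under eq_cvg do rewrite -rec_cos dcsum dssum.
  apply: cvgD; apply: cvgMr; (apply: cvgB; last exact: cvgMr).
    by apply: cvgD; exact: cvgMr.
  by apply: cvgB; exact: cvgMr.
have e := cvg_unique _ h1 h2.
apply/eqP; rewrite -subr_eq0; apply/eqP.
transitivity (r * (r * mckay_xcos t + t * mckay_xsin t - (2 * a + 1) * mckay_cos t) +
  t * (r * mckay_xsin t - t * mckay_xcos t - (2 * a + 1) * mckay_sin t) -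
  b^-1 ^+ 2 * mckay_xcos t); first by ring.
by rewrite e ?subrr.
Qed.

Lemma mckay_xsin_eq t :
  (r ^+ 2 - t ^+ 2 - b^-1 ^+ 2) * mckay_xsin t - 2 * r * t * mckay_xcos t =
  (2 * a + 1) * (r * mckay_sin t - t * mckay_cos t).
Proof.
have S (f : nat -> R) (l : R) : f n @[n --> \oo] --> l -> f n.+1 @[n --> \oo] --> l.
  by rewrite -[X in X -> _]cvg_shiftS.
have h1 : b^-1 ^+ 2 * ssum1 n t @[n --> \oo] --> b^-1 ^+ 2 * mckay_xsin t.
  by apply: cvgMr; exact: cvg_ssum1.
have cc := S _ _ (@cvg_csum t); have ss := S _ _ (@cvg_ssum t).
have cc1 := S _ _ (@cvg_csum1 t); have ss1 := S _ _ (@cvg_ssum1 t).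
have h2 : b^-1 ^+ 2 * ssum1 n t @[n --> \oo] -->
  r * (r * mckay_xsin t - t * mckay_xcos t - (2 * a + 1) * mckay_sin t) -
  t * (r * mckay_xcos t + t * mckay_xsin t - (2 * a + 1) * mckay_cos t).
  under eq_cvg do rewrite -rec_sin dcsum dssum.
  apply: cvgB; apply: cvgMr; (apply: cvgB; last exact: cvgMr).
    by apply: cvgB; exact: cvgMr.
  by apply: cvgD; exact: cvgMr.
have e := cvg_unique _ h1 h2.
apply/eqP; rewrite -subr_eq0; apply/eqP.
transitivity (r * (r * mckay_xsin t - t * mckay_xcos t - (2 * a + 1) * mckay_sin t) -
  t * (r * mckay_xcos t + t * mckay_xsin t - (2 * a + 1) * mckay_cos t) -
  b^-1 ^+ 2 * mckay_xsin t); first by ring.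
by rewrite e ?subrr.
Qed.

Lemma integrable_mckay : mu.-integrable `]0, +oo[ (EFin \o K).
Proof.
have [h _] := cvg_mckay_integral0 a_gt b_gt0 c_gt1 (@measurable_cos_scal R _ 0)
  (fun x => normr_cos_le1 (0 * x)).
apply: eq_integrable h; first exact: measurable_itv0y.
by move=> x _ /=; rewrite mul0r cos0 mulr1.
Qed.

Lemma integrable_xmckay : mu.-integrable `]0, +oo[ (EFin \o (fun x => x * K x)).
Proof.
have [h _] := cvg_mckay_integral1 a_gt b_gt0 c_gt1 (@measurable_cos_scal R _ 0)
  (fun x => normr_cos_le1 (0 * x)).
apply: eq_integrable h; first exact: measurable_itv0y.
by move=> x _ /=; rewrite mul0r cos0 mulr1 mulrC.
Qed.

(** Differentiation under the integral sign. The bound [|x K x|] is uniform in the parameter, so the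
    radius 1 of the neighbourhood of [t] is arbitrary. *)
Lemma is_derive_mckay (h h' : R -> R) t :
  (forall y : R, is_derive y 1 h (h' y)) -> (forall y, `|h y| <= 1) ->
  (forall y, `|h' y| <= 1) ->
  is_derive t 1 (fun t => \int[mu]_(x in `]0, +oo[) (K x * h (t * x)))
    (\int[mu]_(x in `]0, +oo[) (K x * (x * h' (t * x)))).
Proof.
move=> dh h1 h1'.
pose f (t x : R) := K x * h (t * x).
have df (s x : R) : is_derive s 1 (f ^~ x) (K x * (x * h' (s * x))).
  have d1 : is_derive s 1 (fun s : R => s * x) x.
    by apply: (is_derive_eq (is_derive_mul (is_derive_id s 1) (is_derive_cst x s 1)));
      rewrite mul1r mulr0 addr0.
  apply: (is_derive_eq (is_derive_scal (K x) (is_derive_comp (dh _) d1))); ring.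
have intf (s : R) : mu.-integrable `]0, +oo[ (EFin \o f s).
  apply: (RintegrableM_le1 (@measurable_itv0y R) integrable_mckay) => //.
  apply: measurable_funTS; apply: continuous_measurable_fun => x.
  exact: is_derive_continuous (is_derive_comp (dh _) (is_derive_scalid x s)).
have I : (`]t - 1, t + 1[%classic : set R) t.
  by rewrite /= in_itv/=; apply/andP; split; lra.
have G (s x : R) : (`]t - 1, t + 1[%classic : set R) s -> (`]0, +oo[%classic : set R) x ->
    `|partial1of2 f s x| <= `|x * K x|.
  move=> _ _; rewrite partial1of2E derive_val.
  by rewrite mulrA (mulrC (K x)) normrM ler_piMr.
have D := @derivable_under_integral R _ _ mu f `]0%R, +oo[%classic
  (@measurable_itv0y R) t (t - 1) (t + 1) I (fun s _ => intf s)
  (fun s x _ _ => @ex_derive _ _ _ _ _ _ _ (df s x)) (fun x => `|x * K x|)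
  (fun x => normr_ge0 _) (integrable_norm integrable_xmckay) G.
have E := @differentiation_under_integral R _ _ mu f `]0%R, +oo[%classic
  (@measurable_itv0y R) t (t - 1) (t + 1) I (fun s _ => intf s)
  (fun s x _ _ => @ex_derive _ _ _ _ _ _ _ (df s x)) (fun x => `|x * K x|)
  (fun x => normr_ge0 _) (integrable_norm integrable_xmckay) G.
apply: DeriveDef; first exact: D.
rewrite -derive1E E; apply: eq_Rintegral => x _.
by rewrite partial1of2E derive_val.
Qed.

Lemma is_derive_mckay_sin t : is_derive t 1 mckay_sin (mckay_xcos t).
Proof.
by apply: is_derive_mckay => y; [exact: normr_sin_le1|exact: normr_cos_le1].
Qed.

Lemma is_derive_mckay_cos t : is_derive t 1 mckay_cos (- mckay_xsin t).
Proof.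
have := @is_derive_mckay cos (fun y => - sin y) t (fun y => is_derive_cos y)
  (fun y => normr_cos_le1 y) _.
have -> : \int[mu]_(x in `]0, +oo[) (K x * (x * - sin (t * x))) = - mckay_xsin t.
  rewrite -mulN1r -RintegralZl.
  - by apply: eq_Rintegral => x _; ring.
  - exact: measurable_itv0y.
  - by have [] := cvg_mckay_integral1 a_gt b_gt0 c_gt1 (measurable_sin_scal t)
      (fun x => normr_sin_le1 (t * x)).
by apply => y; rewrite normrN normr_sin_le1.
Qed.

End mckay_charfun.

(** * Powers of (1 - i l1 t) (1 - i l2 t) *)

Section gamma_log.
Context {R : realType}.
Implicit Types l t : R.

(* A logarithm of [1 - i l t] is [log_mod l t - i log_arg l t]. *)
Definition log_mod l t : R := ln (1 + (l * t) ^+ 2) / 2.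
Definition log_arg l t : R := atan (l * t).

Let den_gt0 l t : 0 < 1 + (l * t) ^+ 2.
Proof. by rewrite ltr_pwDl// sqr_ge0. Qed.

Lemma is_derive_log_mod l t :
  is_derive t 1 (log_mod l) (l ^+ 2 * t / (1 + (l * t) ^+ 2)).
Proof.
have d1 := is_derive_scalid t l.
have d2 : is_derive t 1 (fun t => 1 + (l * t) * (l * t)) (2 * l ^+ 2 * t).
  apply: (is_derive_eq (is_derive_add (is_derive_cst (1 : R) t 1) (is_derive_mul d1 d1))).
  by rewrite add0r; ring.
have d3 : is_derive (1 + (l * t) * (l * t)) 1 (@ln R) (1 + (l * t) * (l * t))^-1.
  by apply: is_derive1_ln; rewrite -expr2.
have h := is_derive_mul 
  (@is_derive_comp R (@ln R) (fun t => 1 + l * t * (l * t)) t _ _ d3 d2) (is_derive_cst (2^-1 : R) t 1).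
apply: (is_derive_eq h).
by rewrite mulr0 addr0 -!expr2 /=; field; rewrite gt_eqF.
Qed.

Lemma is_derive_log_arg l t :
  is_derive t 1 (log_arg l) (l / (1 + (l * t) ^+ 2)).
Proof.
apply: (is_derive_eq (is_derive_comp (is_derive1_atan _) (is_derive_scalid t l))).
exact: mulrC.
Qed.

Lemma expR_log_mod l t : expR (log_mod l t) ^+ 2 = 1 + (l * t) ^+ 2.
Proof.
rewrite expr2 -expRD /log_mod (_ : _ / 2 + _ = ln (1 + (l * t) ^+ 2)); last by field.
by rewrite lnK// posrE.
Qed.

Lemma expR_log_modE l t : expR (log_mod l t) = Num.sqrt (1 + (l * t) ^+ 2).
Proof. by rewrite -expR_log_mod sqrtr_sqr ger0_norm ?expR_ge0. Qed.

(** With [sin_log_arg]: the exponential of [log_mod + i log_arg] is [1 + i l t], the conjugate of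
    [1 - i l t]. *)
Lemma cos_log_arg l t : expR (log_mod l t) * cos (log_arg l t) = 1.
Proof.
rewrite /log_arg cos_atan -expR_log_modE mulfV// gt_eqF ?expR_gt0//.
Qed.

Lemma sin_log_arg l t : expR (log_mod l t) * sin (log_arg l t) = l * t.
Proof.
have c0 : cos (log_arg l t) != 0.
  by apply/eqP => c0; move/eqP: (cos_log_arg l t); rewrite c0 mulr0 eq_sym oner_eq0.
have : tan (log_arg l t) = l * t by rewrite /log_arg atanK.
rewrite /tan => <-; rewrite -[in LHS](divfK c0 (sin _)) mulrCA cos_log_arg mulr1.
by [].
Qed.

End gamma_log.

(** * Solution of the differential equation *)

Section mckay_charfun_solution.
Context {R : realType}.
Variables a b c : R.
Hypothesis a_gt : - (1 / 2) < a.
Hypothesis b_gt0 : 0 < b.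
Hypothesis c_gt1 : 1 < c.
Implicit Types x t : R.

Let al := a + 1 / 2.
Let l1 := b / (c - 1).
Let l2 := b / (c + 1).
(** [M - i A] is the logarithm of [(1 - i l1 t) (1 - i l2 t)] vanishing at 0, and [M' - i A'] is its
    derivative. *)
Let M t := log_mod l1 t + log_mod l2 t.
Let A t := log_arg l1 t + log_arg l2 t.
Let M' t := l1 ^+ 2 * t / (1 + (l1 * t) ^+ 2) + l2 ^+ 2 * t / (1 + (l2 * t) ^+ 2).
Let A' t := l1 / (1 + (l1 * t) ^+ 2) + l2 / (1 + (l2 * t) ^+ 2).

Local Notation U := (mckay_cos a b c).
Local Notation V := (mckay_sin a b c).

Let l1E t : 1 + (l1 * t) ^+ 2 = ((c - 1) ^+ 2 + (b * t) ^+ 2) / (c - 1) ^+ 2.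
Proof. by rewrite /l1; field; rewrite subr_eq0 gt_eqF. Qed.

Let l2E t : 1 + (l2 * t) ^+ 2 = ((c + 1) ^+ 2 + (b * t) ^+ 2) / (c + 1) ^+ 2.
Proof. by rewrite /l2; field; rewrite gt_eqF// addr_gt0// (lt_trans _ c_gt1). Qed.

Let cB1 : c - 1 != 0. Proof. by rewrite subr_eq0 gt_eqF. Qed.
Let cD1 : c + 1 != 0. Proof. by rewrite gt_eqF// addr_gt0// (lt_trans _ c_gt1). Qed.

Let d1_neq0 t : (c - 1) ^+ 2 + (b * t) ^+ 2 != 0.
Proof. by rewrite gt_eqF// ltr_pwDl ?sqr_ge0// exprn_even_gt0. Qed.

Let d2_neq0 t : (c + 1) ^+ 2 + (b * t) ^+ 2 != 0.
Proof. by rewrite gt_eqF// ltr_pwDl ?sqr_ge0// exprn_even_gt0. Qed.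

Let b_neq0 : b != 0. Proof. by rewrite gt_eqF. Qed.

(** The differential equation is a real linear system in [mckay_xcos] and [mckay_xsin] with
    determinant [|(r - i t)^2 - b^-2|^2]; times [b^4], this is the product of the two positive
    factors cleared in the proof. Solved, with [xsinE], it reads [psi' = - al (M' - i A') psi]. *)
Let xcosE t : mckay_xcos a b c t = al * (A' t * U t - M' t * V t).
Proof.
have e1 := mckay_xcos_eq a_gt b_gt0 c_gt1 t.
have e2 := mckay_xsin_eq a_gt b_gt0 c_gt1 t.
set X := mckay_xcos a b c t in e1 e2 *; set Y := mckay_xsin a b c t in e1 e2.
set u := U t in e1 e2 *; set v := V t in e1 e2 *.
have h : ((c - 1) ^+ 2 + (b * t) ^+ 2) * ((c + 1) ^+ 2 + (b * t) ^+ 2) * X =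
  b ^+ 4 * ((c / b) ^+ 2 - t ^+ 2 - b^-1 ^+ 2) * ((2 * a + 1) * (c / b * u + t * v)) -
  b ^+ 4 * (2 * (c / b) * t) * ((2 * a + 1) * (c / b * v - t * u)).
  by rewrite -e1 -e2; field.
apply: (mulfI (mulf_neq0 (d1_neq0 t) (d2_neq0 t))); rewrite h.
rewrite /A' /M' l1E l2E /l1 /l2 /al; field.
by rewrite cB1 cD1 d1_neq0 d2_neq0 b_neq0.
Qed.

Let xsinE t : mckay_xsin a b c t = al * (M' t * U t + A' t * V t).
Proof.
have e1 := mckay_xcos_eq a_gt b_gt0 c_gt1 t.
have e2 := mckay_xsin_eq a_gt b_gt0 c_gt1 t.
set X := mckay_xcos a b c t in e1 e2; set Y := mckay_xsin a b c t in e1 e2 *.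
set u := U t in e1 e2 *; set v := V t in e1 e2 *.
have h : ((c - 1) ^+ 2 + (b * t) ^+ 2) * ((c + 1) ^+ 2 + (b * t) ^+ 2) * Y =
  b ^+ 4 * ((c / b) ^+ 2 - t ^+ 2 - b^-1 ^+ 2) * ((2 * a + 1) * (c / b * v - t * u)) +
  b ^+ 4 * (2 * (c / b) * t) * ((2 * a + 1) * (c / b * u + t * v)).
  by rewrite -e1 -e2; field.
apply: (mulfI (mulf_neq0 (d1_neq0 t) (d2_neq0 t))); rewrite h.
rewrite /A' /M' l1E l2E /l1 /l2 /al; field.
by rewrite cB1 cD1 d1_neq0 d2_neq0 b_neq0.
Qed.

Let dM t : is_derive t 1 M (M' t).
Proof. exact: is_derive_add (is_derive_log_mod l1 t) (is_derive_log_mod l2 t). Qed.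

Let dA t : is_derive t 1 A (A' t).
Proof. exact: is_derive_add (is_derive_log_arg l1 t) (is_derive_log_arg l2 t). Qed.

Let dU t := is_derive_mckay_cos a_gt b_gt0 c_gt1 t.
Let dV t := is_derive_mckay_sin a_gt b_gt0 c_gt1 t.
Let dE t : is_derive t 1 (fun t => expR (al * M t)) (expR (al * M t) * (al * M' t)).
Proof.
exact: (@is_derive_comp R expR (fun t => al * M t) _ _ _ _ (is_derive_scal al (dM t))).
Qed.

Let dC t : is_derive t 1 (fun t => cos (al * A t)) (- sin (al * A t) * (al * A' t)).
Proof.
exact: (@is_derive_comp R cos (fun t => al * A t) _ _ _ _ (is_derive_scal al (dA t))).
Qed.

Let dS t : is_derive t 1 (fun t => sin (al * A t)) (cos (al * A t) * (al * A' t)).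
Proof.
exact: (@is_derive_comp R sin (fun t => al * A t) _ _ _ _ (is_derive_scal al (dA t))).
Qed.


(* [P + i Q] is the product of [psi] and [((1 - i l1 t) (1 - i l2 t))^al]. *)
Let P t := expR (al * M t) * (U t * cos (al * A t) + V t * sin (al * A t)).
Let Q t := expR (al * M t) * (V t * cos (al * A t) - U t * sin (al * A t)).

Let dP t : is_derive t 1 P 0.
Proof.
apply: (is_derive_eq (is_derive_mul (dE t) (is_derive_add
  (is_derive_mul (dU t) (dC t)) (is_derive_mul (dV t) (dS t))))).
by rewrite xcosE xsinE; ring.
Qed.

Let dQ t : is_derive t 1 Q 0.
Proof.
apply: (is_derive_eq (is_derive_mul (dE t) (is_derive_add
  (is_derive_mul (dV t) (dC t)) (is_derive_opp (is_derive_mul (dU t) (dS t)))))).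
by rewrite xcosE xsinE; ring.
Qed.

Let M0 : M 0 = 0.
Proof. by rewrite /M /log_mod !mulr0 !expr0n/= addr0 ln1 !mul0r addr0. Qed.

Let A0 : A 0 = 0.
Proof. by rewrite /A /log_arg !mulr0 atan0 addr0. Qed.

Let V0 : V 0 = 0.
Proof.
rewrite /mckay_sin; under eq_Rintegral do rewrite mul0r sin0 mulr0.
by rewrite Rintegral_cst ?mul0r//; exact: measurable_itv0y.
Qed.

Let PE t : P t = U 0.
Proof.
rewrite (is_derive_0_is_cst t 0 dP) /P M0 A0 V0.
by rewrite !mulr0 expR0 cos0 mul0r addr0 mulr1 mul1r.
Qed.

Let QE t : Q t = 0.
Proof.
rewrite (is_derive_0_is_cst t 0 dQ) /Q M0 A0 V0.
by rewrite !mulr0 sin0 mul0r mulr0 subrr mulr0.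
Qed.

Lemma mckay_cosE t : mckay_cos a b c t =
  mckay_cos a b c 0 * (expR (- (al * M t)) * cos (al * A t)).
Proof.
have e0 : expR (al * M t) != 0 by rewrite gt_eqF ?expR_gt0.
rewrite expRN; apply: (mulfI e0).
have cs := cos2Dsin2 (al * A t).
(* Rotating [P + i Q] back by the angle [al A] isolates [exp (al M) psi], of which this is the real
   part. *)
transitivity (P t * cos (al * A t) - Q t * sin (al * A t)).
  rewrite -[LHS]mulr1 -cs /P /Q; ring.
by rewrite PE QE; field.
Qed.

Lemma mckay_sinE t : mckay_sin a b c t =
  mckay_cos a b c 0 * (expR (- (al * M t)) * sin (al * A t)).
Proof.
have e0 : expR (al * M t) != 0 by rewrite gt_eqF ?expR_gt0.
rewrite expRN; apply: (mulfI e0).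
have cs := cos2Dsin2 (al * A t).
transitivity (P t * sin (al * A t) + Q t * cos (al * A t)).
  rewrite -[LHS]mulr1 -cs /P /Q; ring.
by rewrite PE QE; field.
Qed.

End mckay_charfun_solution.

(** * Uniqueness of the continuous logarithm along the diagonal *)

Section continuous_logarithm.
Context {R : realType}.
Implicit Types t : R.

(** The values of [f] lie in [2 pi Z]. If [f t] were nonzero, [|f|] would take the value
    [min (|f t|, pi)] by the intermediate value theorem; the cap at [pi] keeps this value where
    [cos] is injective, and there only 0 has cosine 1. *)
Lemma continuous_cos1_eq0 (f : R -> R) t : 0 <= t ->
  {within `[0, t], continuous f} -> f 0 = 0 ->
  (forall s, 0 <= s <= t -> cos (f s) = 1) -> f t = 0.
Proof.
move=> t0 cf f0 cos1; apply/eqP; apply: contraT => ft0.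
have cg : {within `[0, t], continuous (fun x => `|f x|)}.
  by move=> x; apply: cvg_norm; exact: cf.
have p0 := @pi_gt0 R.
pose v := Num.min `|f t| pi.
have v0 : 0 < v by rewrite lt_min normr_gt0 ft0.
have [s sI fs] : exists2 s, s \in `[0, t] & `|f s| = v.
  apply: (IVT t0 cg); rewrite f0 normr0 ge_min le_max.
  by rewrite (ltW v0)/= orbC /v ge_min lexx.
have : cos v = 1 by rewrite -fs cos_norm cos1//; move: sI; rewrite in_itv.
rewrite -cos0 => /cos_inj; rewrite !in_itv/= lexx (ltW v0) (ltW p0)/= ge_min lexx orbT.
by move=> /(_ isT isT) v00; rewrite v00 ltxx in v0.
Qed.

(** The transform of [G1 + G2] at [t] is that of the pair at [(t, t)], so the branch is followed
    along the diagonal. *)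
Lemma diagonal_within_continuous (f : R * R -> R) t :
  {within @quadrant R, continuous f} ->
  {within `[0, t], continuous (fun s => f (s, s))}.
Proof.
move=> /subspace_continuousP cf; apply/subspace_continuousP => x /=.
rewrite in_itv/= => /andP[x0 xt].
apply: (@cvg_comp _ _ _ (fun s => (s, s)) f) (cf (x, x) (conj x0 x0)) => W WQ.
have diag : (fun s : R => (s, s)) @ x --> (x, x) by exact: (cvg_pair cvg_id cvg_id).
have h0 : nbhs x [set s | (@quadrant R) (s, s) -> W (s, s)] := diag _ WQ.
change (nbhs x [set s | (`[0, t]%classic : set R) s -> W (s, s)]).
move: h0; apply: filterS => s /= h; rewrite in_itv/= => /andP[s0 _].
by apply: h; split.
Qed.

Lemma bigamma_det_diag (c1 c12 c2 t : R) :
  bigamma_det (sym2_mx c1 c12 c2) (t, t) =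
  ((1 - (c1 * c2 - c12 ^+ 2) * t ^+ 2) +i* (- ((c1 + c2) * t)))%C.
Proof.
rewrite /bigamma_det (expand_det_row _ 0) !big_ord_recl big_ord0 /cofactor.
rewrite !det_mx11 !mxE !big_ord_recl !big_ord0 !mxE /=.
apply/eqP; rewrite eq_complex /=; apply/andP; split; apply/eqP => /=.
  by rewrite !mulr1n !mulr0n; ring.
by rewrite !mulr1n !mulr0n; ring.
Qed.

(** Moduli determine [X], but [Y] only up to [2 pi Z]; since [Y + A] is continuous, starts at 0 and
    has cosine 1, it vanishes. The hypotheses involve [l1] and [l2] only through their sum and
    product, to be matched with the trace and determinant of [C]. *)
Lemma log_quadratic (l1 l2 t : R) (X Y : R -> R) : 0 <= t ->
  {within `[0, t], continuous Y} -> Y 0 = 0 ->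
  (forall s, 0 <= s <= t -> expR (X s) * cos (Y s) = 1 - l1 * l2 * s ^+ 2 /\
                            expR (X s) * sin (Y s) = - ((l1 + l2) * s)) ->
  X t = log_mod l1 t + log_mod l2 t /\ Y t = - (log_arg l1 t + log_arg l2 t).
Proof.
move=> t0 cY Y0 XY.
pose M s := log_mod l1 s + log_mod l2 s.
pose A s := log_arg l1 s + log_arg l2 s.
have cM s : expR (M s) * cos (A s) = 1 - l1 * l2 * s ^+ 2.
  rewrite /M /A expRD cosD.
  have c1 := cos_log_arg l1 s; have s1 := sin_log_arg l1 s.
  have c2 := cos_log_arg l2 s; have s2 := sin_log_arg l2 s.
  transitivity ((expR (log_mod l1 s) * cos (log_arg l1 s)) *
    (expR (log_mod l2 s) * cos (log_arg l2 s)) -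
    (expR (log_mod l1 s) * sin (log_arg l1 s)) *
    (expR (log_mod l2 s) * sin (log_arg l2 s))); first by ring.
  by rewrite c1 c2 s1 s2; ring.
have sM s : expR (M s) * sin (A s) = (l1 + l2) * s.
  rewrite /M /A expRD sinD.
  have c1 := cos_log_arg l1 s; have s1 := sin_log_arg l1 s.
  have c2 := cos_log_arg l2 s; have s2 := sin_log_arg l2 s.
  transitivity ((expR (log_mod l1 s) * sin (log_arg l1 s)) *
    (expR (log_mod l2 s) * cos (log_arg l2 s)) +
    (expR (log_mod l1 s) * cos (log_arg l1 s)) *
    (expR (log_mod l2 s) * sin (log_arg l2 s))); first by ring.
  by rewrite c1 c2 s1 s2; ring.
have XM s : 0 <= s <= t -> X s = M s.
  move=> st; apply: expR_inj; apply/eqP.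
  rewrite -(eqrXn2 (n := 2)) ?expR_ge0//; apply/eqP.
  have [h1 h2] := XY _ st.
  transitivity ((expR (X s) * cos (Y s)) ^+ 2 + (expR (X s) * sin (Y s)) ^+ 2).
    by rewrite !exprMn -mulrDr cos2Dsin2 mulr1.
  rewrite h1 h2 sqrrN -cM -sM !exprMn -mulrDr cos2Dsin2 mulr1//.
split; first by apply: XM; rewrite t0 lexx.
apply/eqP; rewrite -addr_eq0; apply/eqP.
have cA : continuous A.
  move=> s; exact: is_derive_continuous
    (is_derive_add (is_derive_log_arg l1 s) (is_derive_log_arg l2 s)).
apply: (@continuous_cos1_eq0 (fun s => Y s + A s)) => //.
- by move=> s; apply: cvgD; [exact: cY|exact: (continuous_subspaceT cA)].
- by rewrite Y0 /A /log_arg !mulr0 atan0 !addr0.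
- move=> s st; rewrite cosD.
  have [h1 h2] := XY _ st; rewrite (XM _ st) in h1 h2.
  have e0 : expR (M s) != 0 by rewrite gt_eqF ?expR_gt0.
  have hc : cos (Y s) = cos (A s) by apply: (mulfI e0); rewrite h1 cM.
  have hs : sin (Y s) = - sin (A s) by apply: (mulfI e0); rewrite h2 mulrN sM.
  by rewrite hc hs mulNr opprK -!expr2 cos2Dsin2.
Qed.

End continuous_logarithm.

(** * Uniqueness of Fourier transforms *)

Section poisson_kernel.
Context {R : realType}.
Notation mu := (@lebesgue_measure R).
Implicit Types e t u p q : R.

(* The added constant 1 makes the integrand nonnegative, so that Tonelli's theorem
   suffices below. *)
Lemma integral_expR_cos e u : 0 < e ->
  (\int[mu]_(t in `[0%R, +oo[) (expR (- (e * t)) * (1 + cos (t * u)))%:E =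
   (e^-1 + e / (e ^+ 2 + u ^+ 2))%:E)%E.
Proof.
move=> e0.
have den0 : e ^+ 2 + u ^+ 2 != 0 by rewrite gt_eqF// ltr_pwDl ?sqr_ge0// exprn_gt0.
pose F t := expR (- (e * t)) *
  (- e^-1 + (e ^+ 2 + u ^+ 2)^-1 * (u * sin (u * t) - e * cos (u * t))).
have dF t : is_derive t 1 F (expR (- (e * t)) * (1 + cos (t * u))).
  have dE : is_derive t 1 (fun t => expR (- (e * t))) (expR (- (e * t)) * - e).
    exact: (@is_derive_comp R expR (fun t => - (e * t)) _ _ _ _
      (is_derive_opp (is_derive_scalid t e))).
  have dS : is_derive t 1 (fun t => sin (u * t)) (cos (u * t) * u).
    exact: (@is_derive_comp R sin (fun t => u * t) _ _ _ _ (is_derive_scalid t u)).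
  have dC : is_derive t 1 (fun t => cos (u * t)) (- sin (u * t) * u).
    exact: (@is_derive_comp R cos (fun t => u * t) _ _ _ _ (is_derive_scalid t u)).
  have dG := is_derive_add (is_derive_cst (- e^-1 : R) t 1) (is_derive_scal (e ^+ 2 + u ^+ 2)^-1
    (is_derive_add (is_derive_scal u dS) (is_derive_opp (is_derive_scal e dC)))).
  apply: (is_derive_eq (is_derive_mul dE dG)).
  rewrite (mulrC t) /=; field.
  by rewrite den0 gt_eqF.
have cf t : {for t, continuous (fun t => expR (- (e * t)) * (1 + cos (t * u)))}.
  apply: cvgM.
    apply: is_derive_continuous (is_derive_comp (is_derive_expR _)
      (is_derive_opp (is_derive_scalid t e))).
  apply: cvgD; first exact: cvg_cst.
  under eq_fun do rewrite mulrC.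
  rewrite mulrC.
  exact: is_derive_continuous (is_derive_comp (is_derive_cos _) (is_derive_scalid t u)).
rewrite (@ge0_continuous_FTC2y R _ F 0 0).
- rewrite /F !mulr0 oppr0 expR0 sin0 cos0 mulr0 -EFinB; congr EFin.
  by field; rewrite den0 gt_eqF.
- move=> t _; rewrite mulr_ge0 ?expR_ge0// -lerBlDl sub0r cos_geN1//.
- exact: continuous_subspaceT cf.
- pose B := `|e^-1| + (e ^+ 2 + u ^+ 2)^-1 * (`|u| + `|e|).
  apply: norm_cvg0; apply: (@squeeze_cvgr _ _ _ _ (cst 0) (fun t => B * expR (- (e * t)))).
  + near=> t; rewrite normr_ge0/= /F normrM ger0_norm ?expR_ge0// mulrC.
    apply: ler_wpM2r; first exact: expR_ge0.
    apply: (le_trans (ler_normD _ _)); rewrite normrN; apply: lerD => //.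
    rewrite normrM ger0_norm ?invr_ge0 ?addr_ge0 ?sqr_ge0//.
    apply: ler_wpM2l; first by rewrite invr_ge0 addr_ge0 ?sqr_ge0.
    apply: (le_trans (ler_normB _ _)); rewrite !normrM.
    by apply: lerD; rewrite ler_piMr ?normr_sin_le1 ?normr_cos_le1.
  + exact: cvg_cst.
  + by rewrite -(mulr0 B); apply: cvgM; [exact: cvg_cst|exact: cvgy_expRN].
- by move=> t _; case: (dF t).
- apply: cvg_at_right_filter; exact: is_derive_continuous (dF 0).
- by move=> t _; rewrite derive1E; apply: derive_val.
Unshelve. all: by end_near. Qed.

(** As a function of [x], the difference of arctangents is [pi] times a smoothed indicator of the
    interval; [(q - p) / e] is the contribution of the constant added to the cosine. *)
Lemma integral_poisson_kernel e x p q : 0 < e -> p < q ->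
  (\int[mu]_(y in `[p, q]) (e^-1 + e / (e ^+ 2 + (x - y) ^+ 2))%:E =
   ((q - p) / e + (atan ((q - x) / e) - atan ((p - x) / e)))%:E)%E.
Proof.
move=> e0 pq.
have den0 (y : R) : e ^+ 2 + (x - y) ^+ 2 != 0.
  by rewrite gt_eqF// ltr_pwDl ?sqr_ge0// exprn_gt0.
pose F y := e^-1 * y + atan (e^-1 * (y + - x)).
have dF (y : R) : is_derive y 1 F (e^-1 + e / (e ^+ 2 + (x - y) ^+ 2)).
  have dx : is_derive y 1 (fun y => e^-1 * (y + - x)) e^-1.
    apply: (is_derive_eq (is_derive_scal e^-1
      (is_derive_add (is_derive_id y 1) (is_derive_cst (- x : R) y 1)))).
    by rewrite addr0 mulr1.
  have dA := @is_derive_comp R atan (fun y => e^-1 * (y + - x)) _ _ _ (is_derive1_atan _) dx.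
  apply: (is_derive_eq (is_derive_add (is_derive_scalid y e^-1) dA)).
  by congr (_ + _); field; rewrite den0 gt_eqF//= gt_eqF// ltr_pwDl ?sqr_ge0// exprn_gt0.
have cf (y : R) : {for y, continuous (fun y => e^-1 + e / (e ^+ 2 + (x - y) ^+ 2))}.
  apply: cvgD; first exact: cvg_cst.
  apply: cvgM; first exact: cvg_cst.
  apply: cvgV => //; apply: cvgD; first exact: cvg_cst.
  by apply: cvgM; apply: cvgB; (exact: cvg_cst || exact: cvg_id).
rewrite (@continuous_FTC2 R _ F p q pq).
- by rewrite -EFinB; congr EFin; rewrite /F !(mulrC e^-1); ring.
- exact: continuous_subspaceT cf.
- split.
  + by move=> y _; case: (dF y).
  + by apply: cvg_at_right_filter; exact: is_derive_continuous (dF p).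
  + by apply: cvg_at_left_filter; exact: is_derive_continuous (dF q).
- by move=> y _; rewrite derive1E; apply: derive_val.
Qed.

(** A law enters only through its mass [W] and its cosine and sine transforms on [t >= 0], so equal
    transforms give equal values. The subtracted term removes the effect of the constant added for
    Tonelli. *)
Definition poisson_functional (W : R) (C S : R -> R) e p q : R :=
  fine (\int[mu]_(y in `[p, q]) \int[mu]_(t in `[0%R, +oo[)
    (expR (- (e * t)) * (W + cos (t * y) * C t + sin (t * y) * S t))%:E)%E -
  (q - p) / e * W.

Lemma eq_poisson_functional (W W' : R) (C C' S S' : R -> R) e p q :
  W = W' -> (forall t, 0 <= t -> C t = C' t) -> (forall t, 0 <= t -> S t = S' t) ->
  poisson_functional W C S e p q = poisson_functional W' C' S' e p q.
Proof.
move=> <- CC' SS'; rewrite /poisson_functional.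
under eq_integral => y _.
  rewrite (@eq_integral _ _ _ mu _ (fun t =>
    (expR (- (e * t)) * (W + cos (t * y) * C' t + sin (t * y) * S' t))%:E)).
    over.
  move=> t; rewrite inE/= in_itv/= andbT => t0.
  by rewrite CC' ?SS'.
by [].
Qed.

Lemma ge0_Fubini_on d (T : measurableType d) (m : {sigma_finite_measure set T -> \bar R})
    (D : set (measurableTypeR R)) (g : T -> R -> R) :
  measurable D ->
  measurable_fun setT (fun z : T * measurableTypeR R => g z.1 z.2) ->
  (forall x t, D t -> 0 <= g x t) ->
  (\int[m]_x \int[mu]_(t in D) (g x t)%:E =
   \int[mu]_(t in D) \int[m]_x (g x t)%:E)%E.
Proof.
move=> mD mg g0.
pose f (z : T * measurableTypeR R) : \bar R := (g z.1 z.2 * \1_D z.2)%:E.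
have mf : measurable_fun setT f.
  apply/measurable_EFinP/measurable_funM => //.
  by apply: measurableT_comp; [exact: measurable_indic|exact: measurable_snd].
have f0 z : (0 <= f z)%E.
  rewrite lee_fin indicE; case: (boolP (z.2 \in D)) => h; rewrite ?mulr0 ?mulr1//.
  by case: z h => x t /= /set_mem; exact: g0.
have := fubini_tonelli f mf f0; rewrite /f/= => E.
transitivity (\int[m]_x \int[mu]_t (g x t * \1_D t)%:E)%E.
  apply: eq_integral => x _; rewrite integral_mkcond; apply: eq_integral => t _.
  by rewrite epatch_indic/= EFinM.
rewrite E [RHS]integral_mkcond; apply: eq_integral => t _.
rewrite epatch_indic/= indicE; case: (t \in D) => /=.
  by rewrite mule1; apply: eq_integral => x _; rewrite mulr1.
by rewrite mule0; apply: integral0_eq => x _; rewrite mulr0.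
Qed.

Lemma continuous_poisson_kernel e : 0 < e ->
  continuous (fun y : R => (e^-1 + e / (e ^+ 2 + y ^+ 2) : R)).
Proof.
move=> e0 y; apply: cvgD; first exact: cvg_cst.
apply: cvgM; first exact: cvg_cst.
apply: cvgV; first by rewrite gt_eqF// ltr_pwDl ?sqr_ge0// exprn_gt0.
by apply: cvgD; [exact: cvg_cst|apply: cvgM; exact: cvg_id].
Qed.

End poisson_kernel.

(** * Inversion for the image under X of a measure with density w *)

Section weighted_law.
Context {R : realType} d (T : measurableType d).
Notation mu := (@lebesgue_measure R).
Variables (m : {sigma_finite_measure set T -> \bar R}) (X w : T -> R).
Hypothesis mX : measurable_fun setT X.
Hypothesis w_ge0 : forall x, 0 <= w x.
Hypothesis intw : m.-integrable setT (EFin \o w).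
Implicit Types e t u p q : R.

(** One setting serves both laws: [w = 1] and [X = G1 + G2] on the probability space, and [X = id]
    on the line with [w] the McKay density. *)
Definition weighted_cos t : R := \int[m]_x (w x * cos (t * X x)).
Definition weighted_sin t : R := \int[m]_x (w x * sin (t * X x)).

Let mw : measurable_fun setT w. Proof. exact: (Rintegrable_measurable intw). Qed.

Let integrable_cos t : m.-integrable setT (EFin \o (fun x => w x * cos (t * X x))).
Proof.
apply: RintegrableM_le1 => //; last by move=> x; exact: normr_cos_le1.
by apply: (measurableT_comp (measurable_cos_scal t)).
Qed.

Let integrable_sin t : m.-integrable setT (EFin \o (fun x => w x * sin (t * X x))).
Proof.
apply: RintegrableM_le1 => //; last by move=> x; exact: normr_sin_le1.
by apply: (measurableT_comp (measurable_sin_scal t)).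
Qed.

Lemma integral_weighted_1Dcos e t y :
  (\int[m]_x (w x * (expR (- (e * t)) * (1 + cos (t * (X x - y)))))%:E =
   (expR (- (e * t)) * (\int[m]_x w x + cos (t * y) * weighted_cos t +
                        sin (t * y) * weighted_sin t))%:E)%E.
Proof.
have i1 := RintegrableZl measurableT (cos (t * y)) (integrable_cos t).
have i2 := RintegrableZl measurableT (sin (t * y)) (integrable_sin t).
have i3 := RintegrableD measurableT intw i1.
have i4 := RintegrableD measurableT i3 i2.
have i5 := RintegrableZl measurableT (expR (- (e * t))) i4.
rewrite /weighted_cos /weighted_sin -!RintegralZl// -!RintegralD// -!RintegralZl//.
rewrite fineK; last exact: integrable_fin_num.
apply: eq_integral => x _; congr EFin.
by rewrite mulrBr cosB; ring.
Qed.

(** The arctangents are written as an integral of the kernel over [y], then the kernel as a damped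
    cosine integral over [t]. Moving [m] inside by Tonelli each time leaves [w] integrated against
    [1 + cos (t (X - y))], which the addition formula expresses by the transforms. *)
Lemma weighted_poisson e p q : 0 < e -> p < q ->
  (\int[m]_x (w x * ((q - p) / e + (atan ((q - X x) / e) - atan ((p - X x) / e))))%:E =
   \int[mu]_(y in `[p, q]) \int[mu]_(t in `[0%R, +oo[)
     (expR (- (e * t)) * (\int[m]_x w x + cos (t * y) * weighted_cos t +
                        sin (t * y) * weighted_sin t))%:E)%E.
Proof.
move=> e0 pq.
have mR : measurable (`[0, +oo[%classic : set (measurableTypeR R)) by exact: measurable_itv.
have mI : measurable (`[p, q]%classic : set (measurableTypeR R)) by exact: measurable_itv.
have k_ge0 (y : R) : 0 <= e^-1 + e / (e ^+ 2 + y ^+ 2).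
  by rewrite addr_ge0 ?invr_ge0 ?divr_ge0 ?addr_ge0 ?sqr_ge0 ?(ltW e0).
have c_ge0 (t y : R) : 0 <= expR (- (e * t)) * (1 + cos (t * y)).
  by rewrite mulr_ge0 ?expR_ge0// -lerBlDl sub0r cos_geN1.
have mk := continuous_measurable_fun (continuous_poisson_kernel e0).
have mf : measurable_fun setT (fun z : T * measurableTypeR R => X z.1).
  exact: (measurableT_comp mX measurable_fst).
have mwf : measurable_fun setT (fun z : T * measurableTypeR R => w z.1).
  exact: (measurableT_comp mw measurable_fst).
have mE : measurable_fun setT (fun t : measurableTypeR R => expR (- (e * t))).
  apply: measurableT_comp; first exact: measurable_expR.
  by apply: measurableT_comp => //; apply: measurable_funM.
have mcos : measurable_fun setT (@cos R).
  by apply: continuous_measurable_fun; exact: continuous_cos.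
have m1 : measurable_fun setT (fun z : T * measurableTypeR R =>
    w z.1 * (e^-1 + e / (e ^+ 2 + (X z.1 - z.2) ^+ 2))).
  apply: measurable_funM; first exact: mwf.
  apply: (measurableT_comp mk (measurable_funB mf _)); exact: measurable_snd.
have m2 y : measurable_fun setT (fun z : T * measurableTypeR R =>
    w z.1 * (expR (- (e * z.2)) * (1 + cos (z.2 * (X z.1 - y))))).
  apply: measurable_funM; first exact: mwf.
  apply: measurable_funM; first exact: (measurableT_comp mE measurable_snd).
  apply: measurable_funD; first exact: measurable_cst.
  apply: (measurableT_comp mcos); apply: measurable_funM; first exact: measurable_snd.
  by apply: measurable_funB => //; exact: measurable_cst.
transitivity (\int[m]_x \int[mu]_(y in `[p, q])
    (w x * (e^-1 + e / (e ^+ 2 + (X x - y) ^+ 2)))%:E)%E.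
  apply: eq_integral => x _; rewrite EFinM -(integral_poisson_kernel _ e0 pq).
  rewrite -ge0_integralZl//.
  - apply/measurable_EFinP; apply: measurable_funTS.
    by apply: (measurableT_comp mk); apply: measurable_funB.
  - by move=> y _; rewrite lee_fin.
  - by rewrite lee_fin.
transitivity (\int[mu]_(y in `[p, q]) \int[m]_x
    (w x * (e^-1 + e / (e ^+ 2 + (X x - y) ^+ 2)))%:E)%E.
  by apply: (ge0_Fubini_on m mI m1) => x y _; rewrite mulr_ge0.
apply: eq_integral => y _ /=.
transitivity (\int[m]_x \int[mu]_(t in `[0%R, +oo[)
    (w x * (expR (- (e * t)) * (1 + cos (t * (X x - y)))))%:E)%E.
  apply: eq_integral => x _; rewrite EFinM -(integral_expR_cos _ e0).
  rewrite -ge0_integralZl//.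
  - apply/measurable_EFinP; apply: measurable_funTS.
    apply: measurable_funM; first exact: mE.
    apply: measurable_funD; first exact: measurable_cst.
    by apply: (measurableT_comp mcos); apply: measurable_funM.
  - by rewrite lee_fin.
transitivity (\int[mu]_(t in `[0%R, +oo[) \int[m]_x
    (w x * (expR (- (e * t)) * (1 + cos (t * (X x - y)))))%:E)%E.
  by apply: (ge0_Fubini_on m mR (m2 y)) => x t _; rewrite mulr_ge0.
by apply: eq_integral => t _; exact: integral_weighted_1Dcos.
Qed.

(* Smoothing at width [1 / (n + 1)^2] after a shift by the larger [1 / (n + 1)] yields
   the right-continuous step function, whence no special treatment of atoms. *)
Lemma cvg_smoothed_step (z : R) :
  atan (z * n.+1%:R ^+ 2 + n.+1%:R) @[n --> \oo] -->
  (if 0 <= z then pi / 2 else - (pi / 2)).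
Proof.
case: ifPn => [z0|].
  apply: (@cvg_comp _ _ _ (fun n : nat => z * n.+1%:R ^+ 2 + n.+1%:R) atan); last exact: cvgy_atan.
  apply/cvgryPge => M; near=> n; apply: (@le_trans _ _ n%:R).
    by near: n; exact: nbhs_infty_ger.
  rewrite -[leLHS]add0r; apply: lerD; last by rewrite ler_nat.
  by rewrite mulr_ge0 ?sqr_ge0.
rewrite -ltNge => z0.
under eq_cvg do rewrite -[X in atan X]opprK atanN.
apply: cvgN.
apply: (@cvg_comp _ _ _ (fun n : nat => - (z * n.+1%:R ^+ 2 + n.+1%:R)) atan); last exact: cvgy_atan.
apply/cvgryPge => M; near=> n; apply: (@le_trans _ _ n%:R).
  by near: n; exact: nbhs_infty_ger.
apply: (@le_trans _ _ n.+1%:R); first by rewrite ler_nat.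
have -> : - (z * n.+1%:R ^+ 2 + n.+1%:R) = n.+1%:R * (- z * n.+1%:R - 1) by ring.
rewrite -[leLHS]mulr1 ler_pM2l ?ltr0n// lerBrDr -ler_pdivrMl ?oppr_gt0//.
apply: (@le_trans _ _ n%:R); last by rewrite ler_nat.
by near: n; exact: nbhs_infty_ger.
Unshelve. all: by end_near. Qed.

Let step e p q x := atan ((q - X x) / e) - atan ((p - X x) / e).

Let measurable_step e p q : measurable_fun setT (step e p q).
Proof.
have matan : measurable_fun setT (@atan R).
  by apply: continuous_measurable_fun; exact: continuous_atan.
apply: measurable_funB; apply: (measurableT_comp matan); apply: measurable_funM => //;
  by apply: measurable_funB.
Qed.

Let step_le e p q x : `|step e p q x| <= pi.
Proof.
have a0 := @atan_gtNpi2 R ((q - X x) / e); have a1 := @atan_ltpi2 R ((q - X x) / e).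
have b0 := @atan_gtNpi2 R ((p - X x) / e); have b1 := @atan_ltpi2 R ((p - X x) / e).
by rewrite /step ler_norml; move: a0 a1 b0 b1; lra.
Qed.

Let integrable_step e p q : m.-integrable setT (EFin \o (fun x => w x * step e p q x)).
Proof.
apply: (@le_Rintegrable _ _ _ m _ measurableT _ (fun x => pi * w x)).
- by apply: measurable_funM => //; exact: measurable_step.
- move=> x _; rewrite normrM ger0_norm// mulrC.
  by apply: ler_wpM2r => //; exact: step_le.
- exact: RintegrableZl.
Qed.

Lemma Rintegral_weighted_step e p q : 0 < e -> p < q ->
  \int[m]_x (w x * step e p q x) =
  poisson_functional (\int[m]_x w x) weighted_cos weighted_sin e p q.
Proof.
move=> e0 pq; rewrite /poisson_functional -weighted_poisson// -/(Rintegral _ _ _).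
rewrite -RintegralZl// -RintegralB//; last 2 first.
- have := RintegrableD measurableT (RintegrableZl measurableT ((q - p) / e) intw)
    (integrable_step e p q).
  by apply: eq_integrable => // x _; rewrite /= /step; congr EFin; ring.
- exact: RintegrableZl.
by apply: eq_Rintegral => x _; rewrite /step; ring.
Qed.

Lemma cvg_weighted_step p q : p < q ->
  \int[m]_x (w x * step (n.+1%:R ^- 2) (p + n.+1%:R^-1) (q + n.+1%:R^-1) x) @[n --> \oo] -->
  \int[m]_x (w x * (pi * \1_(`]p, q]%classic) (X x))).
Proof.
move=> pq.
have [] // := @Rintegral_dominated_cvg _ _ _ m setT
  (fun n x => w x * step (n.+1%:R ^- 2) (p + n.+1%:R^-1) (q + n.+1%:R^-1) x)
  (fun x => w x * (pi * \1_(`]p, q]%classic) (X x))) (fun x => pi * w x) measurableT.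
- by move=> n; apply: measurable_funM => //; exact: measurable_step.
- move=> x _; apply: cvgM; first exact: cvg_cst.
  have stepE (z : R) (n : nat) :
      (z + n.+1%:R^-1 - X x) / n.+1%:R ^- 2 = (z - X x) * n.+1%:R ^+ 2 + n.+1%:R.
    have N0 : n.+1%:R != 0 :> R by rewrite pnatr_eq0.
    by move: N0; set N := n.+1%:R => N0; rewrite invrK; field.
  rewrite /step; under eq_cvg do rewrite !stepE.
  suff -> : pi * \1_(`]p, q]%classic) (X x) =
      (if 0 <= q - X x then pi / 2 else - (pi / 2)) -
      (if 0 <= p - X x then pi / 2 else - (pi / 2)) :> R.
    by apply: cvgB; exact: cvg_smoothed_step.
  rewrite !subr_ge0 indicE mem_setE in_itv/=.
  have [xp|px] := leP (X x) p; first by rewrite (le_trans xp (ltW pq)) mulr0 subrr.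
  by case: (leP (X x) q) => xq; rewrite ?mulr1 ?mulr0 opprK ?addNr// -splitr.
- exact: RintegrableZl.
- move=> n x _; rewrite normrM ger0_norm// mulrC.
  by apply: ler_wpM2r => //; exact: step_le.
Qed.

Definition weighted_law (A : set (measurableTypeR R)) : \bar R :=
  (\int[m]_(x in X @^-1` A) (w x)%:E)%E.

(** Uniqueness of measures on a generating class applies to bundled measures; countable additivity
    is inherited from the integral of an integrable function. *)
Lemma weighted_law_measure :
  exists nu : {measure set (measurableTypeR R) -> \bar R}, forall A, nu A = weighted_law A.
Proof.
have h0 : weighted_law set0 = 0%E by rewrite /weighted_law preimage_set0 integral_set0.
have hge0 A : (0 <= weighted_law A)%E.
  by apply: integral_ge0 => x _; rewrite lee_fin.
have hsa : semi_sigma_additive weighted_law.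
  move=> A mA tA mUA; rewrite /weighted_law preimage_bigcup integral_bigcup//=.
  - apply: is_cvg_ereal_nneg_natsum_cond => n _ _; exact: hge0.
  - by move/trivIsetP: tA => tA; apply/trivIsetP => i j _ _ ij;
      rewrite -preimage_setI tA// preimage_set0.
  - move=> k; rewrite -[X in measurable X]setTI; apply: mX => //; exact: mA.
  - apply: (integrableS measurableT) => //.
    by apply: bigcup_measurable => k _; rewrite -[X in measurable X]setTI; apply: mX => //; exact: mA.
pose nu : {measure set (measurableTypeR R) -> \bar R} :=
  HB.pack weighted_law (isMeasure.Build _ _ _ weighted_law h0 hge0 hsa).
by exists nu.
Qed.

Lemma weighted_law_itv p q : p < q ->
  weighted_law `]p, q]%classic = (pi^-1 *
    \int[m]_x (w x * (pi * \1_(`]p, q]%classic) (X x))))%:E.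
Proof.
move=> pq.
have mA : measurable (X @^-1` `]p, q]%classic).
  by rewrite -[X in measurable X]setTI; apply: mX => //; exact: measurable_itv.
rewrite /weighted_law -[LHS]fineK; last first.
  by apply: integrable_fin_num => //; exact: integrableS intw.
congr EFin; rewrite -/(Rintegral _ _ _) Rintegral_mkcond -RintegralZl//; last first.
  apply: (@le_Rintegrable _ _ _ m _ measurableT _ (fun x => pi * w x)).
  - apply: measurable_funM => //; apply: measurable_funM => //.
    by apply: (measurableT_comp _ mX); apply: measurable_indic; exact: measurable_itv.
  - move=> x _; rewrite normrM ger0_norm// mulrC ler_wpM2r//.
    rewrite indicE; case: (_ \in _); rewrite ?mulr1 ?mulr0 ?normr0 ?pi_ge0//.
    by rewrite ger0_norm ?pi_ge0.
  - exact: RintegrableZl.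
apply: eq_Rintegral => x _; rewrite /patch indicE.
have -> : (x \in X @^-1` `]p, q]%classic) = (X x \in `]p, q]%classic).
  by apply/idP/idP; rewrite !inE.
have pi0 : pi != 0 :> R by rewrite gt_eqF// pi_gt0.
case: ifP => _.
  by rewrite mulr1 mulrCA mulVf// mulr1.
by rewrite !mulr0.
Qed.

End weighted_law.

Section uniqueness.
Context {R : realType} d1 d2 (T1 : measurableType d1) (T2 : measurableType d2).
Variables (m1 : {sigma_finite_measure set T1 -> \bar R}) (X1 w1 : T1 -> R).
Variables (m2 : {sigma_finite_measure set T2 -> \bar R}) (X2 w2 : T2 -> R).
Hypothesis mX1 : measurable_fun setT X1.
Hypothesis mX2 : measurable_fun setT X2.
Hypothesis w1_ge0 : forall x, 0 <= w1 x.
Hypothesis w2_ge0 : forall x, 0 <= w2 x.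
Hypothesis intw1 : m1.-integrable setT (EFin \o w1).
Hypothesis intw2 : m2.-integrable setT (EFin \o w2).
Hypothesis cosE : forall t : R, 0 <= t -> weighted_cos m1 X1 w1 t = weighted_cos m2 X2 w2 t.
Hypothesis sinE : forall t : R, 0 <= t -> weighted_sin m1 X1 w1 t = weighted_sin m2 X2 w2 t.

(** The case [t = 0] equates the total masses. Equality on half-open intervals then suffices, as
    they are stable under intersection, generate the Borel sets and exhaust the line with finite
    mass. *)
Lemma weighted_law_unique (A : set (measurableTypeR R)) : measurable A ->
  weighted_law m1 X1 w1 A = weighted_law m2 X2 w2 A.
Proof.
have WE : \int[m1]_x w1 x = \int[m2]_x w2 x.
  have := cosE (lexx 0); rewrite /weighted_cos.
  under eq_Rintegral do rewrite mul0r cos0 mulr1.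
  by under [in X in _ = X -> _]eq_Rintegral do rewrite mul0r cos0 mulr1.
have itvE p q : p < q ->
    weighted_law m1 X1 w1 `]p, q]%classic = weighted_law m2 X2 w2 `]p, q]%classic.
  move=> pq; rewrite !weighted_law_itv//; congr ((_ * _)%:E).
  have h1 := cvg_weighted_step mX1 w1_ge0 intw1 pq.
  have h2 := cvg_weighted_step mX2 w2_ge0 intw2 pq.
  apply: (cvg_unique _ h1) => //; apply: cvg_trans h2.
  apply: near_eq_cvg; apply: nearW => n.
  have e0 : 0 < n.+1%:R ^- 2 :> R by rewrite invr_gt0 exprn_gt0.
  have pq' : p + n.+1%:R^-1 < q + n.+1%:R^-1 by rewrite ltrD2r.
  apply: (etrans (Rintegral_weighted_step mX2 w2_ge0 intw2 e0 pq')).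
  apply: (etrans _ (esym (Rintegral_weighted_step mX1 w1_ge0 intw1 e0 pq'))).
  by apply: eq_poisson_functional => [|t t0|t t0]; rewrite ?WE ?cosE ?sinE.
have [n1 n1E] := weighted_law_measure mX1 w1_ge0 intw1.
have [n2 n2E] := weighted_law_measure mX2 w2_ge0 intw2.
move=> mA; rewrite -n1E -n2E.
apply: (@measure_unique _ R (measurableTypeR R) (@ocitv R) (fun n => `](- n%:R)%R, n%:R]%classic) _ _ _ _ n1 n2) => //.
- exact: ocitvI.
- by move=> n; exact: is_ocitv.
- apply/seteqP; split => // x _.
  near \oo => n; exists n => //=; rewrite in_itv/=.
  have : `|x| < n%:R by near: n; exact: nbhs_infty_gtr.
  by rewrite ltr_norml => /andP[-> /ltW].
- move=> B /ocitvP[->|[x xlt ->]]; first by rewrite !measure0.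
  by rewrite n1E n2E itvE.
- move=> n; rewrite n1E /weighted_law; apply: integrable_lty.
    rewrite -[X in measurable X]setTI; apply: mX1 => //; exact: measurable_itv.
  apply: (integrableS measurableT) intw1 => //.
  rewrite -[X in measurable X]setTI; apply: mX1 => //; exact: measurable_itv.
Unshelve. all: by end_near. Qed.

End uniqueness.

(** * Proof of the theorem *)

Section mckay_density.
Context {R : realType}.
Notation mu := (@lebesgue_measure R).
Variables a b c : R.
Hypothesis a_gt : - (1 / 2) < a.
Hypothesis b_gt0 : 0 < b.
Hypothesis c_gt1 : 1 < c.

Local Notation K := (mckayI_kernel a b c).

(** The partial sums increase to the kernel, so it is bounded below by its positive first term. *)
Lemma mckayI_kernel_gt0 x : 0 < x -> 0 < K x.
Proof.
move=> x0; have cK := @cvg_mckay_partial R a b c a_gt b_gt0 x x0.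
apply: (@lt_le_trans _ _ (mckay_partial a b c 1 x)).
  rewrite /mckay_partial big_ord1 mulr_gt0 ?bessel_coef_gt0//.
  by rewrite mulr_gt0 ?expR_gt0// powR_gt0.
rewrite -(cvg_lim _ cK)//; apply: limr_ge; first by apply/cvg_ex; exists (K x).
exists 1%N => // n /= n1; rewrite /mckay_partial -(subnKC n1) big_split_ord/=.
rewrite lerDl; apply: sumr_ge0 => k _; apply: mulr_ge0; last exact: gamma_weight_ge0.
exact/ltW/bessel_coef_gt0.
Qed.

Lemma mckay_cos0_gt0 : 0 < mckay_cos a b c 0.
Proof.
rewrite /mckay_cos; under eq_Rintegral do rewrite mul0r cos0 mulr1.
apply: Rintegral_itv0y_gt0; first exact: integrable_mckay.
exact: mckayI_kernel_gt0.
Qed.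

(** Written in the shape required by [mckayI_distributed], so that the weighted law with [X = id]
    unfolds to the expected integral. *)
Definition mckay_density x := (mckay_cos a b c 0)^-1 * (K \_ `]0, +oo[) x.

Lemma mckay_density_ge0 x : 0 <= mckay_density x.
Proof.
rewrite mulr_ge0 ?invr_ge0 ?(ltW mckay_cos0_gt0)// /patch.
by case: ifPn => //; rewrite inE/= in_itv/= andbT => /mckayI_kernel_gt0/ltW.
Qed.

Lemma integrable_mckay_density : mu.-integrable setT (EFin \o mckay_density).
Proof.
apply: RintegrableZl => //.
have := integrable_mckay a_gt b_gt0 c_gt1.
by rewrite (integrable_mkcond _ (@measurable_itv0y R)) restrict_EFin.
Qed.

Lemma Rintegral_mckay_density (h : R -> R) :
  mu.-integrable `]0, +oo[ (EFin \o (fun x => K x * h x)) ->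
  \int[mu]_x (mckay_density x * h x) =
  (mckay_cos a b c 0)^-1 * \int[mu]_(x in `]0, +oo[) (K x * h x).
Proof.
move=> intKh; rewrite -RintegralZl//.
rewrite [RHS]Rintegral_mkcond; apply: eq_Rintegral => x _.
by rewrite /mckay_density /patch; case: ifPn => _; rewrite ?mulrA// mulr0 mul0r.
Qed.

Lemma weighted_cos_mckay_density t :
  weighted_cos mu id mckay_density t = (mckay_cos a b c 0)^-1 * mckay_cos a b c t.
Proof.
apply: Rintegral_mckay_density.
by have [] := cvg_mckay_integral0 a_gt b_gt0 c_gt1 (measurable_cos_scal t)
  (fun x => normr_cos_le1 (t * x)).
Qed.

Lemma weighted_sin_mckay_density t :
  weighted_sin mu id mckay_density t = (mckay_cos a b c 0)^-1 * mckay_sin a b c t.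
Proof.
apply: Rintegral_mckay_density.
by have [] := cvg_mckay_integral0 a_gt b_gt0 c_gt1 (measurable_sin_scal t)
  (fun x => normr_sin_le1 (t * x)).
Qed.

End mckay_density.

Section bivariate_gamma_sum.
Context {R : realType} d (T : measurableType d) (P : probability T R).
Variables (G1 G2 : {RV P >-> R}) (alpha c1 c12 c2 l1 l2 : R).
Hypothesis hG : bivariate_gamma P G1 G2 (2 * alpha) (sym2_mx c1 c12 c2).
Hypothesis l12D : l1 + l2 = c1 + c2.
Hypothesis l12M : l1 * l2 = c1 * c2 - c12 ^+ 2.
Implicit Type t : R.

Let M t := log_mod l1 t + log_mod l2 t.
Let A t := log_arg l1 t + log_arg l2 t.

(** Whichever continuous logarithm [L] witnesses the branch, [log_quadratic] forces
    [L (t, t) = M t - i A t]. *)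
Lemma charfun_bivariate_gamma_sum t : 0 <= t ->
  charfun2 P G1 G2 (t, t) =
  ((expR (- (alpha * M t)) * cos (alpha * A t)) +i*
   (expR (- (alpha * M t)) * sin (alpha * A t)))%C.
Proof.
move=> t0; case: hG => L [_ cI L0 hL].
have Q s : 0 <= s -> (@quadrant R) (s, s) by [].
have [XE YE] : complex.Re (L (t, t)) = M t /\ complex.Im (L (t, t)) = - A t.
  apply: (@log_quadratic R l1 l2 t (fun s => complex.Re (L (s, s)))
    (fun s => complex.Im (L (s, s)))) => //.
  - exact: diagonal_within_continuous cI.
  - by rewrite L0.
  - move=> s /andP[s0 _]; have [+ _] := hL _ (Q _ s0).
    by rewrite bigamma_det_diag /expC l12D l12M => -[-> ->].
have [_ ->] := hL _ (Q _ t0).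
rewrite (_ : 2 * alpha / 2 = alpha); last by field.
rewrite /expC; move: XE YE; case: (L (t, t)) => x y /= -> ->.
by rewrite !mul0r subr0 addr0 mulNr mulrNN.
Qed.

Let S : {RV P >-> R} := G1 + G2.

Lemma weighted_cos_sum t : 0 <= t ->
  weighted_cos P S (cst 1) t = expR (- (alpha * M t)) * cos (alpha * A t).
Proof.
move=> t0; have [<- _] := charfun_bivariate_gamma_sum t0.
rewrite unlock; apply: eq_Rintegral => x _.
by rewrite /= mul1r mulrDr.
Qed.

Lemma weighted_sin_sum t : 0 <= t ->
  weighted_sin P S (cst 1) t = expR (- (alpha * M t)) * sin (alpha * A t).
Proof.
move=> t0; have [_ <-] := charfun_bivariate_gamma_sum t0.
rewrite unlock; apply: eq_Rintegral => x _.
by rewrite /= mul1r mulrDr.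
Qed.

End bivariate_gamma_sum.

Unset Implicit Arguments.
Set Strict Implicit.
Set Printing Implicit Defensive.

Theorem corollary2p2 (R : realType) (alpha c1 c12 c2 a b c : R)
    (halpha : 0 < alpha)
    (hC : posdef_mx (sym2_mx c1 c12 c2))
    (ha : - (1 / 2) < a) (hb : 0 < b) (hc : 1 < c)
    (a_def : a = alpha - 1 / 2)
    (b_def : b = 2 * ((c1 * c2 - c12 ^+ 2) /
               Num.sqrt ((c1 + c2) ^+ 2 - 4 * (c1 * c2 - c12 ^+ 2))))
    (c_def : c = (c1 + c2) /
               Num.sqrt ((c1 + c2) ^+ 2 - 4 * (c1 * c2 - c12 ^+ 2)))
    (d : measure_display) (T : measurableType d) (P : probability T R)
    (G1 G2 : {RV P >-> R})
    (hG : bivariate_gamma P G1 G2 (2 * alpha) (sym2_mx c1 c12 c2)) :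
  mckayI_distributed P (G1 + G2 : {RV P >-> R}) a b c.
Proof.
set D := Num.sqrt _ in b_def c_def.
(* If [D] were 0, division by zero would give [c = 0], against [1 < c]. Positivity of [D] in turn
   shows that the radicand is positive. *)
have D0 : 0 < D.
  rewrite lt_neqAle sqrtr_ge0 andbT eq_sym; apply/eqP => D0.
  by move: hc; rewrite c_def D0 invr0 mulr0 ltr10.
have DE : D ^+ 2 = (c1 + c2) ^+ 2 - 4 * (c1 * c2 - c12 ^+ 2).
  by rewrite sqr_sqrtr// ltW// -sqrtr_gt0.
have E0 : c1 * c2 - c12 ^+ 2 != 0.
  by apply: contraTneq hb => E0; rewrite b_def E0 mul0r mulr0 ltxx.
have alphaE : alpha = a + 1 / 2 by rewrite a_def subrK.
have tauE : c1 + c2 = c * D by rewrite c_def divfK ?gt_eqF.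
have deltaE : c1 * c2 - c12 ^+ 2 = b * D / 2.
  by rewrite b_def; field; rewrite gt_eqF.
(* With trace [c D] and determinant [b D / 2], the discriminant formula becomes
   [D^2 = (c D)^2 - 2 b D]; dividing by [D] gives [b]. Then [b / (c - 1)] and [b / (c + 1)] are
   [(c D + D) / 2] and [(c D - D) / 2], the roots of the characteristic polynomial. *)
have bE : b = D * (c ^+ 2 - 1) / 2.
  apply: (mulIf (lt0r_neq0 D0)).
  have : D ^+ 2 = (c * D) ^+ 2 - 4 * (b * D / 2) by rewrite DE deltaE tauE.
  move=> h; apply: (@mulfI _ 2); first by rewrite pnatr_eq0.
  transitivity ((c * D) ^+ 2 - D ^+ 2); first by rewrite h; field.
  by field.
have c1n : c - 1 != 0 by rewrite subr_eq0 gt_eqF.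
have c1p : c + 1 != 0 by rewrite gt_eqF// addr_gt0// (lt_trans _ hc).
have l12D : b / (c - 1) + b / (c + 1) = c1 + c2.
  by rewrite tauE bE; field; rewrite c1n c1p.
have l12M : b / (c - 1) * (b / (c + 1)) = c1 * c2 - c12 ^+ 2.
  by rewrite deltaE [in LHS]bE [in RHS]bE; field; rewrite c1n c1p.
exists (mckay_cos a b c 0)^-1; split; first by rewrite invr_gt0 mckay_cos0_gt0.
move=> A mA.
have U0 := mckay_cos0_gt0 ha hb hc.
transitivity (weighted_law P (G1 + G2 : {RV P >-> R}) (cst 1) A).
  have mS : measurable ((G1 + G2 : {RV P >-> R}) @^-1` A).
    by rewrite -[X in measurable X]setTI; exact: measurable_funP.
  by rewrite -[LHS]mul1e; exact: esym (integral_cst P mS 1%E).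
apply: (@weighted_law_unique R _ _ _ (measurableTypeR R) P _ (cst 1)
  (@lebesgue_measure R) id (mckay_density a b c)) => //.
- by move=> x; exact: mckay_density_ge0.
- exact: finite_measure_integrable_cst.
- exact: integrable_mckay_density.
- move=> t t0; rewrite (weighted_cos_sum hG l12D l12M t0).
  rewrite weighted_cos_mckay_density// (mckay_cosE ha hb hc t) mulKf ?gt_eqF//.
  by rewrite alphaE.
- move=> t t0; rewrite (weighted_sin_sum hG l12D l12M t0).
  rewrite weighted_sin_mckay_density// (mckay_sinE ha hb hc t) mulKf ?gt_eqF//.
  by rewrite alphaE.
Qed.
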